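(* Let $K\in\mathbb R$ and $D\in(0,\infty]$, with $D<\infty$ if $K\le0$, and let $\xi_K$ be the probability measure on $\mathbb R$ $$d\xi_K(x)=\frac1{c_K}e^{-\frac12Kx^2}1_{[-\frac D2,\frac D2]}(x)\,dx,\qquad c_K=\int_{-D/2}^{D/2}e^{-\frac12Kx^2}dx .$$ Then $\Lambda_{LS}(\xi_K)\eqsim\Lambda_{Poi}(\xi_K)$.
   Context: $A\eqsim B$ means that there are universal numeric constants $c,C>0$ (independent of $K$ and $D$) with $cB\le A\le CB$. For a probability measure $\xi$ on $\mathbb R$: $\Lambda_{Poi}(\xi)=\inf\Big\{\frac{\int f'^2d\xi}{\int f^2d\xi}:0\not\equiv f\in C_c^\infty(\mathbb R),\int f\,d\xi=0\Big\}$, and $\Lambda_{LS}(\xi)=\inf_f\frac{2\int f'^2d\xi}{\int f^2\log(f^2)\,d\xi}$, the infimum over $f\in C^\infty(\mathbb R)$ with $f^2=1+g$ for some $0\not\equiv g\in C_c^\infty(\mathbb R)$ with $\int g\,d\xi=0$ (with $0\log0=0$; a quotient with denominator $0$ is $+\infty$). *)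

(* Defs.v *)
From HB Require Import structures.
From mathcomp Require Import all_boot all_order all_algebra.
From mathcomp Require Import all_classical all_reals all_analysis measurable_realfun.
From mathcomp Require Import ring lra.

Set Implicit Arguments.
Unset Strict Implicit.
Unset Printing Implicit Defensive.

Import Order.TTheory GRing.Theory Num.Theory.
Import numFieldNormedType.Exports.

Local Open Scope classical_set_scope.
Local Open Scope ring_scope.

Definition smooth (R : realType) (f : R -> R) : Prop :=
  forall (n : nat) (x : R), derivable (derive1n n f) x 1.

Definition compactly_supported (R : realType) (f : R -> R) : Prop :=
  compact (closure [set x : R | f x != 0]).

Definition test_function (R : realType) (f : R -> R) : Prop :=
  smooth f /\ compactly_supported f.

(* The library's division only gives [a / 0 = +oo] for [a > 0]; here a zero
   denominator gives +oo for every numerator, including 0. *)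
Definition rayleigh (R : realType) (a b : R) : \bar R :=
  if b == 0 then +oo%E else (a / b)%:E.

(* In the two definitions below all the integrands are continuous with compact
   support, so the real-valued integral [Rintegral] is never a default value. *)
Definition Lambda_Poi (R : realType) (xi : probability (measurableTypeR R) R) :
    \bar R :=
  ereal_inf [set q | exists f : R -> R,
    [/\ test_function f, f <> cst 0, \int[xi]_x f x = 0
      & q = rayleigh (\int[xi]_x (derive1 f x) ^+ 2) (\int[xi]_x (f x) ^+ 2)]].

(* [ln 0 = 0] in the library, which agrees with the convention 0 log 0 = 0. *)
Definition Lambda_LS (R : realType) (xi : probability (measurableTypeR R) R) :
    \bar R :=
  ereal_inf [set q | exists f : R -> R,
    [/\ smooth f,
        exists g : R -> R,
          [/\ test_function g, g <> cst 0, \int[xi]_x g x = 0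
            & forall x, (f x) ^+ 2 = 1 + g x]
      & q = rayleigh (2 * \int[xi]_x (derive1 f x) ^+ 2)
                     (\int[xi]_x ((f x) ^+ 2 * ln ((f x) ^+ 2)))]].

Section xi_measure.
Variable R : realType.
Local Notation leb := (@lebesgue_measure R).

(* The interval [-D/2, D/2], equal to the whole line when D = +oo. *)
Definition half_itv (D : \bar R) : set R :=
  [set x | (- (D * 2^-1%:E) <= x%:E <= D * 2^-1%:E)%E].

Definition weight (K x : R) : R := expR (- (2^-1 * K * x ^+ 2)).

Definition norm_const (K : R) (D : \bar R) : R :=
  \int[leb]_(x in half_itv D) weight K x.

Definition xi_pdf (K : R) (D : \bar R) (x : R) : R :=
  (norm_const K D)^-1 * weight K x * \1_(half_itv D) x.

(* The proofs [D0] and [KD] do not enter the formula; they make the measure a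
   probability, as the instances at the end of the section show. *)
Definition xi (K : R) (D : \bar R) (D0 : (0 < D)%E)
    (KD : K <= 0 -> (D < +oo)%E) : set (measurableTypeR R) -> \bar R :=
  fun A => (\int[leb]_(x in A) (xi_pdf K D x)%:E)%E.

Lemma half_itv_fin (d : R) : half_itv d%:E = `[- (d * 2^-1), d * 2^-1]%classic.
Proof.
by apply/seteqP; split => x; rewrite /half_itv /= in_itv/= -?EFinM -?EFinN !lee_fin.
Qed.

Lemma half_itv_pinfty : half_itv +oo = setT.
Proof.
apply/seteqP; split => x // _.
by rewrite /half_itv /mkset gt0_mulye ?lte_fin ?invr_gt0// leey leNye.
Qed.

Lemma measurable_half_itv D : measurable (half_itv D).
Proof.
case: D => [d||].
- by rewrite half_itv_fin.
- by rewrite half_itv_pinfty.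
- rewrite (_ : half_itv -oo = set0)//; apply/seteqP; split => x //.
  by rewrite /half_itv /mkset gt0_mulNye ?lte_fin ?invr_gt0.
Qed.

Lemma continuous_weight K : continuous (weight K).
Proof.
move=> x; apply: (cvg_comp _ expR); last exact: continuous_expR.
apply: (@cvgN _ R^o); apply: cvgM; first exact: cvg_cst.
exact: sqr_continuous.
Qed.

Lemma measurable_weight K A : measurable A -> measurable_fun A (weight K).
Proof.
move=> mA; apply: (@measurable_funS _ _ _ _ setT) => //.
by apply: continuous_measurable_fun; exact: continuous_weight.
Qed.

Lemma integrable_weight K D : (0 < D)%E -> (K <= 0 -> (D < +oo)%E) ->
  leb.-integrable (half_itv D) (EFin \o weight K).
Proof.
case: D => [d _ _|_ KD|//].
- rewrite half_itv_fin; apply: continuous_compact_integrable.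
    exact: segment_compact.
  exact/continuous_subspaceT/continuous_weight.
- rewrite half_itv_pinfty.
  have K0 : 0 < K by rewrite ltNge; apply/negP => /KD.
  pose s := Num.sqrt (K^-1); have s0 : s != 0.
    by rewrite gt_eqF// sqrtr_gt0 invr_gt0.
  rewrite (_ : _ \o _ =
      fun x => ((normal_peak s)^-1%:E * (normal_pdf 0 s x)%:E)%E).
    apply: integrableZl => //; exact: integrable_normal_pdf.
  apply/funext => x /=; rewrite normal_pdfE// -EFinM mulKf; last first.
    by rewrite gt_eqF// normal_peak_gt0.
  rewrite /weight /normal_fun subr0 sqr_sqrtr ?invr_ge0 ?ltW//.
  congr (expR _)%:E; rewrite -mulr_natl; field; exact: lt0r_neq0.
Qed.

Lemma norm_constE K D : (0 < D)%E -> (K <= 0 -> (D < +oo)%E) ->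
  (norm_const K D)%:E = (\int[leb]_(x in half_itv D) (weight K x)%:E)%E.
Proof.
move=> D0 KD; rewrite /norm_const /Rintegral fineK//.
apply: integrable_fin_num; first exact: measurable_half_itv.
exact: integrable_weight.
Qed.

Lemma norm_const_gt0 K D : (0 < D)%E -> (K <= 0 -> (D < +oo)%E) ->
  0 < norm_const K D.
Proof.
move=> D0 KD; rewrite -lte_fin norm_constE//.
have [d [d0 dD d1]] : exists d : R, [/\ 0 < d, (d%:E <= D * 2^-1%:E)%E & d <= 1].
  case: D D0 {KD} => [r r0|_|//].
    exists (Num.min 1 (r * 2^-1)); rewrite lte_fin in r0.
    rewrite lt_min ltr01 ?divr_gt0//; split => //; last by rewrite ge_min lexx.
    by rewrite -EFinM lee_fin ge_min lexx orbT.
  by exists 1; rewrite gt0_mulye ?lte_fin ?invr_gt0// leey.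
have dsub : `[0, d]%classic `<=` half_itv D.
  move=> x; rewrite /half_itv /= in_itv/= => /andP[x0 xd].
  have xD : (x%:E <= D * 2^-1%:E)%E by rewrite (le_trans _ dD)// lee_fin.
  rewrite xD andbT leeNl (le_trans _ xD)// -EFinN lee_fin; lra.
apply: (@lt_le_trans _ _ (\int[leb]_(x in `[0%R, d]) (expR (- `|K|))%:E)%E).
  rewrite integral_cst//= lebesgue_measure_itv/= lte_fin d0 oppr0 adde0 -EFinM.
  by rewrite lte_fin mulr_gt0// expR_gt0.
apply: (@le_trans _ _ (\int[leb]_(x in `[0%R, d]) (weight K x)%:E)%E); last first.
  apply: ge0_subset_integral => //; first exact: measurable_half_itv.
    apply/measurable_EFinP; apply: measurable_weight.
    exact: measurable_half_itv.
  by move=> x _; rewrite lee_fin expR_ge0.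
apply: ge0_le_integral => //.
- by apply/measurable_EFinP; exact: measurable_weight.
- move=> x /=; rewrite in_itv/= => /andP[x0 xd].
  rewrite lee_fin ler_expR lerN2.
  have x1 : x <= 1 by exact: le_trans d1.
  have K0 := normr_ge0 K.
  have x2 : x ^+ 2 <= 1 by rewrite expr_le1.
  have h1 : K * x ^+ 2 <= `|K| * x ^+ 2 by rewrite ler_wpM2r ?sqr_ge0 ?ler_norm.
  have h2 : `|K| * x ^+ 2 <= `|K| by rewrite ler_piMr.
  rewrite -mulrA; lra.
Qed.

Lemma xi_pdf_ge0 K D x : 0 <= xi_pdf K D x.
Proof.
rewrite /xi_pdf !mulr_ge0 ?expR_ge0// ?invr_ge0.
by apply: Rintegral_ge0 => y _; rewrite expR_ge0.
Qed.

Lemma measurable_xi_pdf K D : measurable_fun setT (xi_pdf K D).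
Proof.
apply: measurable_funM; last exact: measurable_indic (measurable_half_itv D).
by apply: measurable_funM => //; exact: measurable_weight.
Qed.

Lemma integral_xi_pdf K D : (0 < D)%E -> (K <= 0 -> (D < +oo)%E) ->
  (\int[leb]_x (xi_pdf K D x)%:E = 1)%E.
Proof.
move=> D0 KD; have c0 := norm_const_gt0 D0 KD.
transitivity (\int[leb]_(x in half_itv D)
    ((norm_const K D)^-1%:E * (weight K x)%:E))%E.
  rewrite [RHS]integral_mkcond; apply: eq_integral => x _.
  rewrite patchE /xi_pdf indicE; case: ifPn => _; last by rewrite mulr0.
  by rewrite mulr1 EFinM.
rewrite integralZl//; last exact: integrable_weight.
  by rewrite -norm_constE// -EFinM mulVf// gt_eqF.
exact: measurable_half_itv.
Qed.

Section xi_probability.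
Variables (K : R) (D : \bar R) (D0 : (0 < D)%E) (KD : K <= 0 -> (D < +oo)%E).

Let xi0 : xi D0 KD set0 = 0%E.
Proof. by rewrite /xi integral_set0. Qed.

Let xi_ge0 A : (0 <= xi D0 KD A)%E.
Proof. by apply: integral_ge0 => x _; rewrite lee_fin xi_pdf_ge0. Qed.

Let xi_sigma_additive : semi_sigma_additive (xi D0 KD).
Proof.
move=> A mA tA mUA; rewrite /xi ge0_integral_bigcup//=; last 2 first.
- apply/measurable_EFinP/(@measurable_funS _ _ _ _ setT) => //.
  exact: measurable_xi_pdf.
- by move=> x _; rewrite lee_fin xi_pdf_ge0.
apply: is_cvg_ereal_nneg_natsum_cond => n _ _.
by apply: integral_ge0 => x _; rewrite lee_fin xi_pdf_ge0.
Qed.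

HB.instance Definition _ := isMeasure.Build _ _ _
  (xi D0 KD) xi0 xi_ge0 xi_sigma_additive.

Let xi_setT : xi D0 KD setT = 1%E.
Proof. exact: integral_xi_pdf. Qed.

HB.instance Definition _ :=
  Measure_isProbability.Build _ _ R (xi D0 KD) xi_setT.

End xi_probability.
End xi_measure.

(* Main.v *)
(* Both constants are compared with an explicit rate. Let w be the density of
   xi_K up to a constant, f smooth, E = \int f'^2 w and m a value of f. The
   entropy of f^2 is bounded pointwise by (f - m)^2 + (1 - |m|)^2, up to a factor
   log (f^2) where |f| is large, and (1 - |m|)^2 is at most the mean of
   (f - m)^2. There are two regimes.
   - If K > 0 and K^(-1/2) <= D/2, the bound (f x - f 0)^2 w <= E |x| turns
     log (f^2) into K x^2 plus a constant, and integrating the derivative of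
     x (f - f 0)^2 w bounds K \int x^2 (f - f 0)^2 w, since the boundary terms
     have the good sign; hence Lambda_LS >= c K, and a bump of width K^(-1/2)
     shows that Lambda_Poi <= C K.
   - Otherwise the oscillation of f on [-D/2, D/2] is at most
     (E \int w^-1)^(1/2), whence Lambda_LS >= c / (\int w \int w^-1); with l the
     minimum of D/2 and |K|^(-1/2) one has \int w^-1 <= C l, and a step of width
     l shows that Lambda_Poi <= C / (l \int w).
   The bound Lambda_LS <= C Lambda_Poi is the linearisation f = sqrt (1 + e h). *)
Require Import Defs.
From mathcomp Require Import all_boot all_order all_algebra.
From mathcomp Require Import all_classical all_reals all_analysis.
From mathcomp Require Import ring lra measurable_realfun.
Set Implicit Arguments.
Unset Strict Implicit.
Unset Printing Implicit Defensive.
Import Order.TTheory GRing.Theory Num.Theory.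
Import numFieldNormedType.Exports.
Local Open Scope ring_scope.

(** * Smooth functions and cut-offs *)

Section smooth_functions.
Local Open Scope classical_set_scope.
Local Open Scope ring_scope.
Variable R : realType.
Implicit Types (f g h : R -> R) (n : nat).

(** Differentiability to order [n], peeling the derivative off the inside, so that the product and
    chain rules follow by induction on the order; [derive1n] peels it off the outside. *)
Fixpoint smoothn n f : Prop :=
  if n is n'.+1 then (forall x, derivable f x 1) /\ smoothn n' (derive1 f)
  else True.

Lemma derive1n_derive1 n f : derive1n n (derive1 f) = derive1n n.+1 f.
Proof. by elim: n => [//|n IHn]; rewrite derive1nS IHn -derive1nS. Qed.

Lemma smoothP f : smooth f <-> forall n, smoothn n f.
Proof.
split=> [sf n|].
  elim: n f sf => [//|n IHn] f sf /=; split; first exact: (sf 0%N).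
  by apply: IHn => k x; rewrite derive1n_derive1; exact: sf.
move=> sf n; elim: n f sf => [|n IHn] f sf x; first by case: (sf 1%N).
by rewrite -derive1n_derive1; apply: IHn => k; case: (sf k.+1).
Qed.

Lemma smooth_derivable f x : smooth f -> derivable f x 1.
Proof. by move=> /(_ 0%N x). Qed.

Lemma smooth_derive1 f : smooth f -> smooth (derive1 f).
Proof. by move=> sf n x; rewrite derive1n_derive1; exact: sf. Qed.

Lemma is_derive1E f (df : R -> R) :
  (forall x : R, is_derive x (1 : R) f (df x)) -> derive1 f = df.
Proof. by move=> h; apply/funext => x; rewrite derive1E; apply: derive_val. Qed.

Lemma smooth_is_derive f (x : R) : smooth f -> is_derive x (1 : R) f (derive1 f x).
Proof.
by move=> sf; rewrite derive1E; apply: derivableP; exact: smooth_derivable.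
Qed.

Lemma smooth_continuous f : smooth f -> continuous f.
Proof.
move=> sf x; apply: differentiable_continuous.
exact/derivable1_diffP/smooth_derivable.
Qed.

Lemma smoothnS n f (df : R -> R) : (forall x : R, is_derive x (1 : R) f (df x)) ->
  smoothn n df -> smoothn n.+1 f.
Proof. by move=> h s /=; rewrite (is_derive1E h); split. Qed.

Lemma smoothn_derivable n f (x : R) :
  smoothn n.+1 f -> is_derive x (1 : R) f (derive1 f x).
Proof. by case=> df _; rewrite derive1E; exact: derivableP. Qed.

Lemma smoothnW n f : smoothn n.+1 f -> smoothn n f.
Proof. by elim: n f => [//|n IHn] f [df sf]; split => //; exact: IHn. Qed.

Lemma smoothn_cst n (a : R) : smoothn n (cst a).
Proof.
elim: n a => [//|n IHn] a.
exact: (smoothnS (fun x => is_derive_cst a x 1) (IHn 0)).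
Qed.

Lemma smoothn_id n : smoothn n (@id R).
Proof.
case: n => [//|n].
exact: (smoothnS (fun x => is_derive_id x 1) (smoothn_cst n 1)).
Qed.

Lemma smoothnD n f g :
  smoothn n f -> smoothn n g -> smoothn n (fun x => f x + g x).
Proof.
elim: n f g => [//|n IHn] f g sf sg.
have d x := is_deriveD (smoothn_derivable x sf) (smoothn_derivable x sg).
exact: (smoothnS d (IHn _ _ sf.2 sg.2)).
Qed.

Lemma smoothnM n f g :
  smoothn n f -> smoothn n g -> smoothn n (fun x => f x * g x).
Proof.
elim: n f g => [//|n IHn] f g sf sg.
have d x := is_deriveM (smoothn_derivable x sf) (smoothn_derivable x sg).
exact: (smoothnS d (smoothnD (IHn _ _ (smoothnW sf) sg.2)
  (IHn _ _ (smoothnW sg) sf.2))).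
Qed.

Lemma smoothn_comp n f g : smooth f -> smoothn n g -> smoothn n (f \o g).
Proof.
elim: n f g => [//|n IHn] f g sf sg.
have d x := is_derive1_comp (smooth_is_derive (g x) sf) (smoothn_derivable x sg).
exact: (smoothnS d (smoothnM (IHn _ _ (smooth_derive1 sf) (smoothnW sg)) sg.2)).
Qed.

Lemma smooth_cst (a : R) : smooth (fun=> a).
Proof. by apply/smoothP => n; exact: smoothn_cst. Qed.

Arguments smooth_cst a : clear implicits.

Lemma smooth_id : smooth (@id R).
Proof. by apply/smoothP => n; exact: smoothn_id. Qed.

Lemma smoothD f g : smooth f -> smooth g -> smooth (fun x => f x + g x).
Proof. by move=> /smoothP sf /smoothP sg; apply/smoothP => n; exact: smoothnD. Qed.

Lemma smoothM f g : smooth f -> smooth g -> smooth (fun x => f x * g x).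
Proof. by move=> /smoothP sf /smoothP sg; apply/smoothP => n; exact: smoothnM. Qed.

Lemma smoothN f : smooth f -> smooth (fun x => - f x).
Proof.
move=> sf; rewrite (_ : (fun x => _) = fun x => -1 * f x); last first.
  by apply/funext => x; rewrite mulN1r.
exact: (smoothM (smooth_cst (- 1)) sf).
Qed.

Lemma smoothB f g : smooth f -> smooth g -> smooth (fun x => f x - g x).
Proof. by move=> sf sg; exact: (smoothD sf (smoothN sg)). Qed.

Lemma smoothX f n : smooth f -> smooth (fun x => f x ^+ n).
Proof.
move=> sf; elim: n => [|n IHn]; first by under eq_fun do rewrite expr0; exact: smooth_cst.
by under eq_fun do rewrite exprS; exact: smoothM.
Qed.

Arguments smoothX [f] n _.

Lemma smooth_comp f g : smooth f -> smooth g -> smooth (fun x => f (g x)).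
Proof. by move=> sf /smoothP sg; apply/smoothP => n; exact: smoothn_comp. Qed.

Lemma smooth_expR : smooth (@expR R).
Proof.
apply/smoothP; elim=> [//|n IHn].
exact: (smoothnS (@is_derive_expR R) IHn).
Qed.

(* All derivatives of [h^(-1/2)] are polynomials in [h^(-1/2)] and in the
   derivatives of [h], since [(h^(-1/2))' = - h' / 2 * (h^(-1/2))^3]. *)
Lemma smooth_rsqrt h : (forall x, 0 < h x) -> smooth h ->
  smooth (fun x => (Num.sqrt (h x))^-1).
Proof.
move=> h0 sh; apply/smoothP; elim=> [//|n IHn]; set r := fun x => _ in IHn *.
have sh' := (smoothP _).1 (smooth_derive1 sh) n.
suff d (x : R) : is_derive x (1 : R) r
    (- 2^-1 * derive1 h x * (r x * (r x * r x))).
  exact: (smoothnS d (smoothnM (smoothnM (smoothn_cst _ _) sh')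
    (smoothnM IHn (smoothnM IHn IHn)))).
have s0 : Num.sqrt (h x) != 0 by rewrite gt_eqF// sqrtr_gt0.
have dh := smooth_is_derive x sh.
have ds : is_derive x (1 : R) (Num.sqrt \o h) ((2 * Num.sqrt (h x))^-1 * derive1 h x).
  by apply: is_derive1_comp; exact: is_derive1_sqrt.
have dr := @is_deriveV _ (Num.sqrt \o h) x _ _ s0 ds.
apply: (@is_derive_eq _ _ _ _ _ _ _ _ dr); rewrite /r /GRing.scale /=.
by field; rewrite s0.
Qed.

(** Written as [h * h^(-1/2)], the square root inherits smoothness from [smooth_rsqrt]; likewise the
    inverse below is the square of [h^(-1/2)]. *)
Lemma smooth_sqrt h : (forall x, 0 < h x) -> smooth h ->
  smooth (fun x => Num.sqrt (h x)).
Proof.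
move=> h0 sh; rewrite (_ : (fun x => _) = fun x => h x * (Num.sqrt (h x))^-1).
  exact: (smoothM sh (smooth_rsqrt h0 sh)).
apply/funext => x; have s0 : Num.sqrt (h x) != 0 by rewrite gt_eqF// sqrtr_gt0.
by rewrite -{2}[h x]sqr_sqrtr ?ltW// expr2 mulfK.
Qed.

Lemma smoothV h : (forall x, 0 < h x) -> smooth h -> smooth (fun x => (h x)^-1).
Proof.
move=> h0 sh.
rewrite (_ : (fun x => _) = fun x => (Num.sqrt (h x))^-1 * (Num.sqrt (h x))^-1).
  by apply: smoothM; exact: smooth_rsqrt.
by apply/funext => x; rewrite -invfM -expr2 sqr_sqrtr ?ltW.
Qed.

(** [flat 0] is the classical smooth function [exp (-1/x)] that vanishes to infinite order at 0. The
    powers [x^-n] make the family closed under differentiation, up to linear combinations. *)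
Definition flat n (x : R) : R := if 0 < x then x ^- n * expR (- x^-1) else 0.

(** With [y = 1/x], the exponential series gives [y^(n+1) <= (n+1)! exp y]. The bound forces
    [flat n] to tend to 0 at 0. *)
Lemma flat_le n x : `|flat n x| <= n.+1`!%:R * `|x|.
Proof.
rewrite /flat; case: ifPn => [x0|_]; last by rewrite normr0 mulr_ge0.
have xi0 : 0 < x^-1 by rewrite invr_gt0.
rewrite !gtr0_norm ?mulr_gt0 ?expR_gt0 ?invr_gt0 ?exprn_gt0//.
have h : x^-1 ^+ n.+1 <= n.+1`!%:R * expR x^-1.
  rewrite -ler_pdivrMl ?ltr0n ?fact_gt0// mulrC.
  by apply: le_trans (expR_ge1Dxn n (ltW xi0)); rewrite lerDr.
rewrite expRN -exprVn -ler_pdivlMr ?invr_gt0 ?expR_gt0// invrK.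
rewrite exprS mulrC in h.
rewrite -ler_pdivlMr// in h; apply: (le_trans h).
by rewrite invrK mulrAC.
Qed.

Lemma is_derive_flat n (x : R) :
  is_derive x (1 : R) (flat n) (flat n.+2 x - n%:R * flat n.+1 x).
Proof.
have [x0|x0|->] := ltgtP x 0.
- have -> : flat n.+2 x - n%:R * flat n.+1 x = 0.
    by rewrite /flat ltNge ltW// mulr0 subr0.
  apply: (@near_eq_is_derive _ _ _ (cst 0)).
  by near=> y; rewrite /flat ifF//; apply/negbTE; rewrite -leNgt ltW//; near: y; exact: lt_nbhsl.
- pose f y : R := (y^-1) ^+ n * expR (- y^-1).
  have dV : is_derive x (1 : R) (fun y : R => y^-1) (- x ^- 2).
    have := @is_deriveV _ id x 1 1 (lt0r_neq0 x0) (is_derive_id _ _).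
    by rewrite /GRing.scale/= mulr1.
  have dX := @is_deriveX _ _ _ n _ _ _ dV.
  have dE : is_derive x (1 : R) (fun y => expR (- y^-1)) (expR (- x^-1) * x ^- 2).
    have dN := @is_deriveN _ _ _ _ _ _ _ dV; rewrite opprK in dN.
    exact: (@is_derive1_comp _ expR _ _ _ _ (is_derive_expR _) dN).
  have := @is_deriveM _ _ _ _ _ _ _ _ dX dE => df.
  apply: (@near_eq_is_derive _ _ _ f) => //.
    by near=> y; rewrite /flat ifT /f ?exprVn//; near: y; exact: lt_nbhsr.
  rewrite exprfctE in df; apply: (@is_derive_eq _ _ _ _ _ _ _ _ df).
  rewrite /flat x0 /GRing.scale/= exprVn /f.
  rewrite -!exprVn; case: (n) => [|m] /=; last by rewrite !exprS; ring.
  by rewrite mulr0n !expr0 exprS expr1; ring.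
- have -> : flat n.+2 0 - n%:R * flat n.+1 0 = 0.
    by rewrite /flat ltxx mulr0 subr0.
  (* At 0 the difference quotient of [flat n] is [flat n.+1], which tends to 0 by [flat_le]. *)
  suff lim0 : (h : R)^-1 *: (flat n (h *: (1 : R) + 0) - flat n 0)
      @[h --> (0 : R)^'] --> (0 : R).
    apply: DeriveDef; first by apply/cvg_ex; exists 0.
    by rewrite /derive; exact/cvg_lim.
  have flat0 : flat n.+1 y @[y --> (0:R)] --> (0 : R).
    apply/norm_cvg0P.
    apply: (@squeeze_cvgr _ _ _ _ (cst 0) (fun y : R => n.+2`!%:R * `|y|)).
    + by near=> y; rewrite normr_ge0 /= flat_le.
    + exact: cvg_cst.
    + rewrite -[X in _ --> X](mulr0 n.+2`!%:R); apply: cvgM; first exact: cvg_cst.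
      by rewrite -[X in _ --> X](@normr0 _ R); exact: (@norm_continuous _ R).
  apply: cvg_trans (cvg_within_filter _ flat0).
  apply: near_eq_cvg; near=> y.
  rewrite addr0 /GRing.scale/= mulr1 /flat ltxx subr0; case: ifPn => //; rewrite ?mulr0//.
  by move=> y0; rewrite mulrA exprS invfM.
Unshelve. all: by end_near. Qed.

Lemma smooth_flat n : smooth (flat n).
Proof.
apply/smoothP => m; elim: m n => [//|m IHm] n.
apply: (smoothnS (is_derive_flat n)).
have := smoothnD (IHm n.+2) (smoothnM (smoothn_cst m (- n%:R)) (IHm n.+1)).
by under eq_fun do rewrite mulNr.
Qed.

Arguments smooth_flat n : clear implicits.

(** The denominator is positive because one of [x] and [1 - x] is. In this quotient form the values
    at [x] and [1 - x] add up to 1, which later makes [odd_step] odd. *)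
Definition smooth_step (x : R) : R := flat 0 x / (flat 0 x + flat 0 (1 - x)).

Lemma flat_ge0 n x : 0 <= flat n x.
Proof.
by rewrite /flat; case: ifPn => // x0; rewrite mulr_ge0 ?expR_ge0// invr_ge0 exprn_ge0// ltW.
Qed.

Lemma flat_gt0 n x : 0 < x -> 0 < flat n x.
Proof. by move=> x0; rewrite /flat x0 mulr_gt0 ?expR_gt0// invr_gt0 exprn_gt0. Qed.

Lemma flat_eq0 n x : x <= 0 -> flat n x = 0.
Proof. by move=> x0; rewrite /flat ltNge x0. Qed.

Lemma smooth_step_den_gt0 x : 0 < flat 0 x + flat 0 (1 - x).
Proof.
have [x0|x0] := ltP 0 x; first by rewrite ltr_pwDl ?flat_gt0 ?flat_ge0.
by rewrite ltr_wpDl ?flat_gt0 ?flat_ge0//; lra.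
Qed.

Lemma smooth_smooth_step : smooth smooth_step.
Proof.
apply: (smoothM (smooth_flat 0)).
apply: (smoothV smooth_step_den_gt0).
apply: (smoothD (smooth_flat 0)); apply: (smooth_comp (smooth_flat 0)).
exact: (smoothB (smooth_cst _) smooth_id).
Qed.

Lemma smooth_step0 x : x <= 0 -> smooth_step x = 0.
Proof. by move=> x0; rewrite /smooth_step flat_eq0// mul0r. Qed.

Lemma smooth_step_sym x : smooth_step (1 - x) = 1 - smooth_step x.
Proof.
have := smooth_step_den_gt0 x => /lt0r_neq0 h.
by rewrite /smooth_step subKr; field; rewrite ?h// addrC h.
Qed.

Lemma smooth_step1 x : 1 <= x -> smooth_step x = 1.
Proof.
move=> x1; have := smooth_step_sym (1 - x); rewrite subKr => ->.
by rewrite smooth_step0 ?subr0//; lra.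
Qed.

End smooth_functions.

Arguments smooth_cst {R} a.
Arguments smooth_id {R}.
Arguments smoothX {R f} n.
Arguments smooth_expR {R}.
Arguments smooth_flat {R} n.

(** * Integrals over compact intervals *)

Section interval_integrals.
Variable R : realType.
Local Open Scope classical_set_scope.
Local Open Scope ring_scope.
Local Notation leb := (@lebesgue_measure R).
Implicit Types (a b c d k x : R) (f g p F : R -> R).

(** An unoriented integral: it is 0 when [b < a]. *)
Definition itgl a b f : R := \int[leb]_(x in `[a, b]) f x.

Definition itgble a b f := leb.-integrable `[a, b] (EFin \o f).

Lemma continuous_mul f g :
  continuous f -> continuous g -> continuous (fun x => f x * g x).
Proof. by move=> cf cg x; apply: cvgM; [exact: cf|exact: cg]. Qed.

Lemma continuous_sqr f : continuous f -> continuous (fun x => f x ^+ 2).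
Proof. by move=> cf; under eq_fun do rewrite expr2; exact: continuous_mul. Qed.

Lemma continuous_itgble a b f : continuous f -> itgble a b f.
Proof.
move=> cf; apply: continuous_compact_integrable; first exact: segment_compact.
exact/continuous_subspaceT.
Qed.

Lemma itgbleD a b f g :
  itgble a b f -> itgble a b g -> itgble a b (fun x => f x + g x).
Proof. by move=> hf hg; exact: (integrableD _ hf hg). Qed.

Lemma itgbleZ a b k f : itgble a b f -> itgble a b (fun x => k * f x).
Proof. by move=> hf; exact: (integrableZl _ k hf). Qed.

Lemma le_itgl a b f g : itgble a b f -> itgble a b g ->
  (forall x, a <= x <= b -> f x <= g x) -> itgl a b f <= itgl a b g.
Proof.
by move=> hf hg fg; apply: le_Rintegral => // x /=; rewrite in_itv/=; exact: fg.
Qed.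

Lemma itglD a b f g : itgble a b f -> itgble a b g ->
  itgl a b (fun x => f x + g x) = itgl a b f + itgl a b g.
Proof. by move=> hf hg; rewrite /itgl RintegralD. Qed.

Lemma itglZ a b k f : itgble a b f ->
  itgl a b (fun x => k * f x) = k * itgl a b f.
Proof. by move=> hf; rewrite /itgl RintegralZl. Qed.

Lemma itgl_ge0 a b f : (forall x, 0 <= f x) -> 0 <= itgl a b f.
Proof. by move=> f0; apply: Rintegral_ge0. Qed.

Lemma itgl_cst a b k : a <= b -> itgl a b (fun=> k) = k * (b - a).
Proof.
move=> ab; rewrite /itgl Rintegral_cst//= lebesgue_measure_itv/= lte_fin.
by case: ltgtP ab => // -> _; rewrite subrr.
Qed.

Lemma le_itgl_subset a b c d f : a <= c -> d <= b -> itgble a b f ->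
  (forall x, 0 <= f x) -> itgl c d f <= itgl a b f.
Proof.
move=> ac db hf f0; have sub : `[c, d] `<=` `[a, b].
  by apply: subset_itv; rewrite bnd_simp.
rewrite /itgl /Rintegral fine_le//.
- by apply: integrable_fin_num => //; exact: integrableS hf.
- exact: integrable_fin_num.
- apply: ge0_subset_integral => //; last by move=> x _; rewrite lee_fin.
  exact: measurable_int hf.
Qed.

Lemma itgl_split a c b f : a <= c -> c <= b -> itgble a b f ->
  itgl a b f = itgl a c f + itgl c b f.
Proof.
move=> ac cb hf; have := @Rintegral_itvB _ f (BLeft a) (BRight b) c hf.
rewrite !bnd_simp => /(_ ac cb) /eqP; rewrite subr_eq addrC => /eqP.
rewrite /itgl => ->; congr (_ + _); rewrite Rintegral_itv_obnd_cbnd//.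
by apply: integrableS hf => //; apply: subset_itv; rewrite bnd_simp.
Qed.

Lemma itgl_derive a b (F f : R -> R) : a <= b -> continuous f ->
  (forall x, is_derive x (1 : R) F (f x)) -> itgl a b f = F b - F a.
Proof.
rewrite le_eqVlt => /predU1P[->|ab] cf dF.
  by rewrite subrr /itgl set_itv1 Rintegral_set1.
have cF x : {for x, continuous F}.
  by apply: differentiable_continuous; apply/derivable1_diffP.
have h : derivable_oo_LRcontinuous F a b.
  split => [x _||]; first exact: ex_derive.
    by apply: cvg_within_filter; exact: cF.
  by apply: cvg_within_filter; exact: cF.
rewrite /itgl /Rintegral (@continuous_FTC2 _ f F)//.
  exact/continuous_subspaceT.
by move=> x _; rewrite derive1E; apply: derive_val.
Qed.

(** On the compact interval [f] attains its minimum, a positive constant below [f]. *)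
Lemma itgl_gt0 a b f : a < b -> continuous f -> (forall x, 0 < f x) ->
  0 < itgl a b f.
Proof.
move=> ab cf f0.
have [y _ fy] := EVT_min (ltW ab) (continuous_subspaceT cf).
apply: (@lt_le_trans _ _ (itgl a b (fun=> f y))).
  by rewrite itgl_cst ?(ltW ab)// mulr_gt0 ?subr_gt0.
apply: le_itgl; [exact/continuous_itgble/cst_continuous|exact: continuous_itgble|].
by move=> x xab; apply: fy; rewrite in_itv.
Qed.

(* Expand [0 <= \int (f' - t / p)^2 p] at the optimal [t]. *)
Lemma itgl_cauchy_schwarz a b (f f' p : R -> R) : a <= b ->
  continuous f' -> continuous p -> (forall x, 0 < p x) ->
  (forall x, is_derive x (1 : R) f (f' x)) ->
  (f b - f a) ^+ 2 <=
    itgl a b (fun x => f' x ^+ 2 * p x) * itgl a b (fun x => (p x)^-1).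
Proof.
rewrite le_eqVlt => /predU1P[->|ab] cf' cp p0 df.
  rewrite subrr expr0n/= mulr_ge0//; apply: itgl_ge0 => x.
    by rewrite mulr_ge0 ?sqr_ge0// ltW.
  by rewrite invr_ge0 ltW.
have cV : continuous (fun x => (p x)^-1).
  by move=> x; apply: cvgV; [rewrite gt_eqF|exact: cp].
have cE : continuous (fun x => f' x ^+ 2 * p x).
  by apply: continuous_mul => //; exact: continuous_sqr.
set A := itgl _ _ _; set B := itgl _ _ _; pose D := f b - f a.
have B0 : 0 < B by apply: itgl_gt0 => // x; rewrite invr_gt0.
have DE : itgl a b f' = D by exact: (itgl_derive (ltW ab)).
have h t : 0 <= A - 2 * t * D + t ^+ 2 * B.
  have -> : A - 2 * t * D + t ^+ 2 * B = itgl a b (fun x => (f' x - t / p x) ^+ 2 * p x).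
    rewrite -DE -mulNr -2?itglZ; try exact: continuous_itgble.
    rewrite -2?itglD; last first.
    - exact/itgbleZ/continuous_itgble.
    - exact: continuous_itgble.
    - exact/itgbleZ/continuous_itgble.
    - by apply: itgbleD; [|apply: itgbleZ]; exact: continuous_itgble.
    congr itgl; apply/funext => x; field; exact: lt0r_neq0.
  by apply: itgl_ge0 => x; rewrite mulr_ge0 ?sqr_ge0// ltW.
have := h (D / B); rewrite -(pmulr_lge0 _ B0).
have -> : (A - 2 * (D / B) * D + (D / B) ^+ 2 * B) * B = A * B - D ^+ 2.
  by field; exact: lt0r_neq0.
by rewrite subr_ge0.
Qed.

End interval_integrals.

(** * Pointwise entropy bounds *)

Section log_sobolev.
Variable R : realType.
Local Open Scope classical_set_scope.
Local Open Scope ring_scope.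
Implicit Types (K L s m d x : R) (f w : R -> R).

Lemma ln_le_subr1 (y : R) : 0 < y -> ln y <= y - 1.
Proof. by move=> y0; have := @le_ln1Dx _ (y - 1); rewrite subrKC; apply; lra. Qed.

(** For [s > 0] the left-hand side is [2 s^2 - 2 s], and [ln s >= 1 - 1/s]. The square on the left
    is the gain over the convexity bound [s^2 - 1]. *)
Lemma xlnx_ge s : s ^+ 2 - 1 + (`|s| - 1) ^+ 2 <= s ^+ 2 * ln (s ^+ 2).
Proof.
rewrite -real_normK ?num_real//; have := normr_ge0 s; move: `|s| => {}s.
rewrite le_eqVlt => /predU1P[<-|s0]; first by rewrite !expr2; lra.
have h : 1 - s^-1 <= ln s.
  have := @ln_le_subr1 s^-1; rewrite invr_gt0 s0 lnV ?posrE// => /(_ isT); lra.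
rewrite lnXn// -mulr_natl.
suff : s ^+ 2 * (2 * (1 - s^-1)) <= s ^+ 2 * (2 * ln s).
  apply: le_trans; rewrite le_eqVlt; apply/orP; left; apply/eqP; field.
  exact: lt0r_neq0.
by rewrite ler_pM2l ?exprn_gt0// ler_pM2l.
Qed.

Lemma xlnx_le s : s ^+ 2 * ln (s ^+ 2) <= s ^+ 2 * (s ^+ 2 - 1).
Proof.
have [->|s0] := eqVneq s 0; first by rewrite expr0n/= !mul0r.
by rewrite ler_wpM2l ?sqr_ge0// ln_le_subr1// exprn_even_gt0.
Qed.

(** Split [|s| - 1] as [(|s| - |m|) + (|m| - 1)] and use [(u + v)^2 <= 2 u^2 + 2 v^2]. *)
Lemma sqr_dist1_le s m :
  (`|s| - 1) ^+ 2 <= 2 * ((s - m) ^+ 2 + (1 - `|m|) ^+ 2).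
Proof.
have h : (`|s| - `|m|) ^+ 2 <= (s - m) ^+ 2.
  rewrite -[leRHS]real_normK ?num_real// -[leLHS]real_normK ?num_real//.
  by rewrite lerXn2r ?nnegrE// ler_dist_dist.
move: h; move: (`|s|) (`|m|) ((s - m) ^+ 2) => a b c h.
have := sqr_ge0 (a - 2 * b + 1); nra.
Qed.

(* For [|s| <= 2] the left-hand side is quadratic in [|s| - 1]; for [|s| > 2]
   the distance from [|s|] to [1] is comparable to [|s|], so one of
   [|s - m|], [|1 - |m||] is of the size of [|s|]. *)
Lemma xlnx_dist_le s m l1 l2 : 0 <= l1 -> 0 <= l2 ->
  8 * ((s - m) ^+ 2 + (1 - `|m|) ^+ 2) <= expR (l1 + l2) ->
  s ^+ 2 * ln (s ^+ 2) - s ^+ 2 + 1 <=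
    18 * ((s - m) ^+ 2 + (1 - `|m|) ^+ 2) + l1 * s ^+ 2 +
    8 * (l2 * ((s - m) ^+ 2 + (1 - `|m|) ^+ 2)).
Proof.
move=> l10 l20; have := sqr_dist1_le s m; set q := (s - m) ^+ 2 + _ => dq qe.
have q0 : 0 <= q by rewrite addr_ge0 ?sqr_ge0.
have l1s : 0 <= l1 * s ^+ 2 by rewrite mulr_ge0 ?sqr_ge0.
have l2q : 0 <= l2 * q by rewrite mulr_ge0.
have s2 : s ^+ 2 = `|s| ^+ 2 by rewrite real_normK ?num_real.
have a0 := normr_ge0 s.
have [le2|gt2] := leP `|s| 2.
  have := xlnx_le s; rewrite s2.
  (* The factor 18 is this 9 times the 2 of [sqr_dist1_le]. *)
  have : (`|s| + 1) ^+ 2 <= 9 by nra.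
  have : 0 <= (`|s| - 1) ^+ 2 by rewrite sqr_ge0.
  have -> : `|s| ^+ 2 * (`|s| ^+ 2 - 1) =
    (`|s| - 1) ^+ 2 * (`|s| + 1) ^+ 2 + `|s| ^+ 2 - 1 by ring.
  rewrite -s2; nra.
(* For [|s| > 2] one has [|s| <= 2 (|s| - 1)], hence [s^2 <= 4 (|s| - 1)^2 <= 8 q]; the hypothesis
   then bounds the logarithm by [l1 + l2]. *)
have sq : s ^+ 2 <= 8 * q by rewrite s2; nra.
have s0 : 0 < s ^+ 2 by rewrite s2; nra.
have lns : ln (s ^+ 2) <= l1 + l2.
  by rewrite -[leRHS]expRK ler_ln ?posrE ?expR_gt0// (le_trans sq).
have : s ^+ 2 * ln (s ^+ 2) <= s ^+ 2 * (l1 + l2) by rewrite ler_wpM2l// ltW.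
have : s ^+ 2 * l2 <= 8 * q * l2 by rewrite ler_wpM2r.
nra.
Qed.

Lemma continuous_bounded f (a b : R) : continuous f ->
  exists2 M : R, 0 <= M & forall x, a <= x <= b -> `|f x| <= M.
Proof.
move=> cf; have cn : continuous (fun x => `|f x|).
  by move=> x; apply: continuous_comp; [exact: cf|exact: norm_continuous].
have [ab|ba] := leP a b.
  have [y _ hy] := EVT_max ab (continuous_subspaceT cn).
  by exists `|f y| => // x xab; apply: hy; rewrite in_itv.
by exists 0 => // x /andP[ax xb]; have := le_lt_trans (le_trans ax xb) ba; rewrite ltxx.
Qed.

(** The integrand is treated as bounded and measurable: [s^2 ln (s^2)] lies between [-1] and [s^4],
    so the zeros of [f] call for no separate argument. *)
Lemma itgble_xlnx f w (a b : R) : continuous f -> continuous w ->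
  itgble a b (fun x => f x ^+ 2 * ln (f x ^+ 2) * w x).
Proof.
move=> cf cw.
have mf : measurable_fun setT f by exact: continuous_measurable_fun.
have mw : measurable_fun setT w by exact: continuous_measurable_fun.
have [M M0 fM] := @continuous_bounded f a b cf.
have [N N0 wN] := @continuous_bounded w a b cw.
apply: measurable_bounded_integrable => //.
- by rewrite /= lebesgue_measure_itv/=; case: ifP; rewrite ?ltry.
- apply: (@measurable_funS _ _ _ _ setT) => //.
  apply: measurable_funM => //; apply: measurable_funM.
    exact: measurable_funX.
  by apply: (measurableT_comp (@measurable_ln R)); exact: measurable_funX.
- exists ((1 + M ^+ 4) * N); split; first exact: num_real.
  move=> e he x /=; rewrite in_itv/= => xab; apply/ltW/(le_lt_trans _ he).
  rewrite normrM ler_pM ?wN//.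
  have h1 := xlnx_ge (f x); have h2 := xlnx_le (f x).
  have h3 := fM x xab; rewrite -[f x ^+ 2]real_normK ?num_real// in h1 h2 *.
  rewrite ler_norml; have f0 := normr_ge0 (f x).
  move: `|f x| h1 h2 h3 f0 => y h1 h2 h3 y0.
  have yM : y ^+ 4 <= M ^+ 4 by rewrite lerXn2r ?nnegrE.
  have y4 : y ^+ 4 = y ^+ 2 * y ^+ 2 by rewrite -exprD.
  have M4 : 0 <= M ^+ 4 by rewrite exprn_ge0.
  have := sqr_ge0 y; have := sqr_ge0 (y - 1).
  by move=> ? ?; apply/andP; split; nra.
Qed.

(** * Entropy with respect to a positive weight on an interval *)

Section weighted.
Variables (a b : R) (w f : R -> R).
Hypotheses (ab : a <= b) (cw : continuous w) (w0 : forall x, 0 < w x).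
Hypotheses (cf : continuous f).
Hypothesis f_mean : itgl a b (fun x => (f x ^+ 2 - 1) * w x) = 0.

Let c := itgl a b w.

Let cfw (g : R -> R) : continuous g -> continuous (fun x => g x * w x).
Proof. by move=> cg; exact: continuous_mul. Qed.

Let c_sqr (g : R -> R) : continuous g -> continuous (fun x => g x ^+ 2).
Proof. exact: continuous_sqr. Qed.

Let cB m : continuous (fun x => f x - m).
Proof. by move=> x; apply: cvgB; [exact: cf|exact: cvg_cst]. Qed.

Let mass_ge0 : 0 <= c.
Proof. by apply: itgl_ge0 => x; exact: ltW. Qed.

Let f2_mass : itgl a b (fun x => f x ^+ 2 * w x) = c.
Proof.
have h : itgl a b (fun x => (f x ^+ 2 - 1) * w x + w x) = c.
  rewrite itglD ?f_mean ?add0r//; last exact: continuous_itgble.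
  apply: continuous_itgble; apply: cfw => x.
  by apply: cvgB; [exact: c_sqr|exact: cvg_cst].
by rewrite -h; congr itgl; apply/funext => x; ring.
Qed.

(* [f] has norm [1] in [L^2(w / c)], so that the triangle inequality bounds the
   distance of [|m|] to [1] by the norm of [f - m]. *)
Lemma sqr_dist1_mass_le m :
  (1 - `|m|) ^+ 2 * c <= itgl a b (fun x => (f x - m) ^+ 2 * w x).
Proof.
set V := itgl _ _ _; pose p := itgl a b (fun x => (f x - m) * w x).
have cV : continuous (fun x => (f x - m) ^+ 2 * w x) by exact/cfw/c_sqr.
have cp : continuous (fun x => (f x - m) * w x) by exact: cfw.
have V0 : 0 <= V by apply: itgl_ge0 => x; rewrite mulr_ge0 ?sqr_ge0// ltW.
have quad t : 0 <= V + t * p * 2 + t ^+ 2 * c.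
  have -> : V + t * p * 2 + t ^+ 2 * c = itgl a b (fun x => (f x - m + t) ^+ 2 * w x).
    rewrite mulrAC -2?itglZ; try exact: continuous_itgble.
    rewrite -2?itglD; last first.
    - exact/itgbleZ/continuous_itgble.
    - exact: continuous_itgble.
    - exact/itgbleZ/continuous_itgble.
    - by apply: itgbleD; [|apply: itgbleZ]; exact: continuous_itgble.
    by congr itgl; apply/funext => x; ring.
  by apply: itgl_ge0 => x; rewrite mulr_ge0 ?sqr_ge0// ltW.
have := mass_ge0; rewrite le_eqVlt => /predU1P[<-|c0]; first by rewrite mulr0.
have cE : c = V + m * p * 2 + m ^+ 2 * c.
  rewrite -{1}f2_mass mulrAC -2?itglZ; try exact: continuous_itgble.
  rewrite -2?itglD; last first.
  - exact/itgbleZ/continuous_itgble.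
  - exact: continuous_itgble.
  - exact/itgbleZ/continuous_itgble.
  - by apply: itgbleD; [|apply: itgbleZ]; exact: continuous_itgble.
  by congr itgl; apply/funext => x; ring.
pose q := p / c; have pE : p = q * c by rewrite /q divfK// gt_eqF.
have VE : V = (1 - 2 * (m * q) - m ^+ 2) * c.
  by rewrite pE in cE; move: cE; rewrite mulrA; lra.
(* [m + q] is the mean of [f] for [w / c]; [quad] at [t = - q] says that the variance is
   nonnegative. What remains to prove is [m (m + q) <= |m|]. *)
have mq : (m + q) ^+ 2 <= 1.
  have := quad (- q); rewrite pE VE.
  have -> : (1 - 2 * (m * q) - m ^+ 2) * c + - q * (q * c) * 2 + (- q) ^+ 2 * c =
    (1 - (m + q) ^+ 2) * c by ring.
  by rewrite pmulr_lge0// subr_ge0.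
rewrite VE ler_pM2r//.
have [m0|m0] := leP 0 m.
  rewrite ger0_norm//; suff : m + q <= 1 by nra.
  nra.
rewrite ltr0_norm//; suff : -1 <= m + q by nra.
nra.
Qed.

(** This integrates [xlnx_dist_le]. The constant [l1] costs [l1 c] because [f^2 w] has mass [c]; the
    variable [l2] stays under the integral, to be absorbed by a second-moment bound. The terms
    [- f^2 + 1] integrate to 0, and [(1 - |m|)^2 c <= \int (f - m)^2 w] turns 18 into 36. *)
Lemma entropy_le m l1 (l2 : R -> R) : 0 <= l1 -> continuous l2 ->
  (forall x, 0 <= l2 x) ->
  (forall x, a <= x <= b ->
    8 * ((f x - m) ^+ 2 + (1 - `|m|) ^+ 2) <= expR (l1 + l2 x)) ->
  itgl a b (fun x => f x ^+ 2 * ln (f x ^+ 2) * w x) <=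
    36 * itgl a b (fun x => (f x - m) ^+ 2 * w x) + l1 * c +
    8 * (itgl a b (fun x => l2 x * (f x - m) ^+ 2 * w x) +
         (1 - `|m|) ^+ 2 * itgl a b (fun x => l2 x * w x)).
Proof.
move=> l10 cl2 l20 hl; set d := (1 - `|m|) ^+ 2.
set V := itgl a b (fun x => (f x - m) ^+ 2 * w x).
have dV : d * c <= V by exact: sqr_dist1_mass_le.
have iV : itgble a b (fun x => (f x - m) ^+ 2 * w x).
  exact/continuous_itgble/cfw/c_sqr.
have iw : itgble a b w by exact: continuous_itgble.
have if2 : itgble a b (fun x => f x ^+ 2 * w x).
  exact/continuous_itgble/cfw/c_sqr.
have il : itgble a b (fun x => l2 x * w x) by exact/continuous_itgble/cfw.
have ilV : itgble a b (fun x => l2 x * (f x - m) ^+ 2 * w x).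
  by apply/continuous_itgble/cfw/continuous_mul => //; exact: c_sqr.
pose rhs x := ((18 * ((f x - m) ^+ 2 * w x) + (18 * d - 1) * w x) +
  (l1 + 1) * (f x ^+ 2 * w x)) +
  8 * (l2 x * (f x - m) ^+ 2 * w x + d * (l2 x * w x)).
have irhs : itgble a b rhs.
  by rewrite /rhs; do ! [exact: iV|exact: iw|exact: if2|exact: il|exact: ilV
    |apply: itgbleD|apply: itgbleZ].
apply: (@le_trans _ _ (itgl a b rhs)).
  apply: le_itgl => //; first exact: itgble_xlnx.
  move=> x xab; have := xlnx_dist_le l10 (l20 x) (hl x xab).
  rewrite -/d -(ler_pM2r (w0 x)) /rhs => h; lra.
rewrite /rhs.
rewrite itglD; [|by do ! [exact: iV|exact: iw|exact: if2|exact: il|exact: ilV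
    |apply: itgbleD|apply: itgbleZ]..].
rewrite itglD; [|by do ! [exact: iV|exact: iw|exact: if2|exact: il|exact: ilV
    |apply: itgbleD|apply: itgbleZ]..].
rewrite itglD; [|by do ! [exact: iV|exact: iw|exact: if2|exact: il|exact: ilV
    |apply: itgbleD|apply: itgbleZ]..].
rewrite !itglZ//; last by apply: itgbleD => //; exact: itgbleZ.
rewrite itglD//; last exact: itgbleZ.
rewrite itglZ// f2_mass -/V -/c; lra.
Qed.

End weighted.
End log_sobolev.

(** * Log-Sobolev inequalities on an interval *)

Section log_sobolev_gauss.
Variable R : realType.
Local Open Scope classical_set_scope.
Local Open Scope ring_scope.
Implicit Types (K L x : R) (f w : R -> R).

(** Cauchy-Schwarz from the left endpoint gives [(f x - f a)^2 <= E B] throughout. So [entropy_le]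
    applies with [m = f a], [l1 = 16 E B] and [l2 = 0], because [16 E B <= exp (16 E B)]; the
    constant is [52 = 36 + 16]. *)
Lemma log_sobolev_oscillation a b w f : a < b -> continuous w ->
  (forall x, 0 < w x) -> smooth f ->
  itgl a b (fun x => (f x ^+ 2 - 1) * w x) = 0 ->
  itgl a b (fun x => f x ^+ 2 * ln (f x ^+ 2) * w x) <=
    52 * (itgl a b w * itgl a b (fun x => (w x)^-1)) *
    itgl a b (fun x => derive1 f x ^+ 2 * w x).
Proof.
move=> ab cw w0 sf f_mean; have cf := smooth_continuous sf.
have cf' := smooth_continuous (smooth_derive1 sf).
set c := itgl a b w; set B := itgl a b (fun x => (w x)^-1).
set E := itgl a b (fun x => derive1 f x ^+ 2 * w x).
have c0 : 0 < c by exact: itgl_gt0.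
have B0 : 0 <= B by apply: itgl_ge0 => x; rewrite invr_ge0 ltW.
have E0 : 0 <= E by apply: itgl_ge0 => x; rewrite mulr_ge0 ?sqr_ge0// ltW.
have cV : continuous (fun x => (w x)^-1).
  by move=> x; apply: cvgV; [rewrite gt_eqF|exact: cw].
have osc x : a <= x <= b -> (f x - f a) ^+ 2 <= E * B.
  move=> /andP[ax xb].
  apply: le_trans (itgl_cauchy_schwarz ax cf' cw w0 _) _ => [y|].
    exact: smooth_is_derive.
  apply: ler_pM.
  - by apply: itgl_ge0 => y; rewrite mulr_ge0 ?sqr_ge0// ltW.
  - by apply: itgl_ge0 => y; rewrite invr_ge0 ltW.
  - apply: le_itgl_subset => //; last by move=> y; rewrite mulr_ge0 ?sqr_ge0// ltW.
    by apply/continuous_itgble/continuous_mul => //; exact: continuous_sqr.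
  - apply: le_itgl_subset => //; first exact: continuous_itgble.
    by move=> y; rewrite invr_ge0 ltW.
have V_le : itgl a b (fun x => (f x - f a) ^+ 2 * w x) <= E * B * c.
  rewrite -itglZ; last exact: continuous_itgble.
  apply: le_itgl.
  - apply/continuous_itgble/continuous_mul => //; apply: continuous_sqr => x.
    by apply: cvgB; [exact: cf|exact: cvg_cst].
  - exact/itgbleZ/continuous_itgble.
  - by move=> x xab; rewrite ler_wpM2r ?osc// ltW.
have dV := sqr_dist1_mass_le cw w0 cf f_mean (f a).
have d_le : (1 - `|f a|) ^+ 2 <= E * B.
  by rewrite -(ler_pM2r c0); exact: le_trans dV V_le.
have EB0 : 0 <= E * B by rewrite mulr_ge0.
have := @entropy_le _ a b w f cw w0 cf f_mean (f a) (16 * (E * B)) (fun=> 0).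
rewrite -/c (_ : (fun x => 0 * w x) = fun=> 0); last by apply/funext => x; rewrite mul0r.
rewrite (_ : (fun x => 0 * _ * w x) = fun=> 0); last by apply/funext => x; rewrite !mul0r.
rewrite itgl_cst ?(ltW ab)// !(mul0r, mulr0, addr0).
move=> h; apply: (le_trans (h _ _ _ _)).
- by rewrite mulr_ge0.
- exact: cst_continuous.
- by [].
- move=> x xab; rewrite ?addr0; apply: le_trans (expR_ge1Dx _).
  by clear h; have := osc x xab; lra.
- clear h; have : 52 * (c * B) * E = 36 * (E * B * c) + 16 * (E * B) * c by ring.
  lra.
Qed.

Lemma smooth_weight K : smooth (weight K).
Proof.
apply: (smooth_comp smooth_expR).
exact: (smoothN (smoothM (smooth_cst (2^-1 * K)) (smoothX 2 smooth_id))).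
Qed.

Arguments smooth_weight K : clear implicits.

Lemma is_derive_weight K x :
  is_derive x (1 : R) (weight K) (- (K * x) * weight K x).
Proof.
have dX := @is_deriveX _ _ _ 2 _ _ _ (is_derive_id x (1 : R)).
have dN := is_deriveN (is_deriveZ (2^-1 * K) dX).
apply: (@is_derive_eq _ _ _ _ _ _ _ _ (is_derive1_comp (is_derive_expR _) dN)).
rewrite /GRing.scale/= /weight expr1 /GRing.scale/=.
rewrite [X in expR X * _](_ : _ = - (2^-1 * K * x ^+ 2)); last by [].
by field.
Qed.


(** * The Gaussian weight on a symmetric interval, with constants independent of its length *)

Section gauss_interval.
Variables K L : R.
Hypotheses (K0 : 0 < K) (L0 : 0 < L).
Let w := weight K.
Let c := itgl (- L) L w.
Let w0 x : 0 < w x. Proof. exact: expR_gt0. Qed.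
Let cw : continuous w. Proof. exact: continuous_weight. Qed.
Let LL : - L < L. Proof. by rewrite (lt_trans _ L0)// oppr_lt0. Qed.
Let c0 : 0 < c. Proof. exact: itgl_gt0. Qed.
Let rK := Num.sqrt K.
Let rK0 : 0 < rK. Proof. by rewrite sqrtr_gt0. Qed.
Let rK2 : rK ^+ 2 = K. Proof. by rewrite sqr_sqrtr// ltW. Qed.

(* [exp (- K x^2 / 2) <= 2 / (1 + K x^2)], whose integral is an arctangent. *)
Lemma gauss_mass_le : c * rK <= 8.
Proof.
have dG x : is_derive x (1 : R) (fun y => 2 / rK * atan (rK * y))
    (2 / (1 + K * x ^+ 2)).
  have dl := is_deriveZ rK (is_derive_id x (1 : R)).
  have da : is_derive (rK * x) (1 : R) (@atan R) ((1 + (rK * x) ^+ 2)^-1).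
    by rewrite -derive1_atan derive1E; apply: derivableP; exact: derivable_atan.
  have := is_deriveZ (2 / rK) (is_derive1_comp da dl) => dG.
  apply: (@is_derive_eq _ _ _ _ _ _ _ _ dG); rewrite /GRing.scale/= mulr1 -rK2 exprMn.
  set d := (1 + rK ^+ 2 * x ^+ 2)^-1; clearbody d.
  by field; rewrite gt_eqF.
have den x : 0 < 1 + K * x ^+ 2 by rewrite ltr_pwDl// mulr_ge0 ?sqr_ge0 ?ltW.
have cg : continuous (fun x => 2 / (1 + K * x ^+ 2)).
  move=> x; apply: cvgM; first exact: cvg_cst.
  apply: cvgV; first by rewrite gt_eqF.
  apply: cvgD; first exact: cvg_cst.
  by apply: cvgM; [exact: cvg_cst|exact: exprn_continuous].
have : c <= 2 / rK * 4.
  apply: (@le_trans _ _ (itgl (- L) L (fun x => 2 / (1 + K * x ^+ 2)))).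
    apply: le_itgl; [exact: continuous_itgble|exact: continuous_itgble|].
    move=> x _; rewrite /w /weight expRN.
    have h := expR_ge1Dx (2^-1 * K * x ^+ 2).
    rewrite -[leRHS]invf_div lef_pV2 ?posrE ?expR_gt0 ?divr_gt0//.
    lra.
  rewrite (itgl_derive (ltW LL) cg dG) -mulrBr ler_wpM2l ?divr_ge0 ?(ltW rK0)//.
  have := atan_ltpi2 (rK * L); have := atan_gtNpi2 (rK * - L).
  have /andP[_] := @pihalf_02 R; lra.
rewrite -(ler_pM2r rK0) => /le_trans; apply.
by rewrite mulrAC divfK ?gt_eqF//; lra.
Qed.

(** The derivative of [P = x v^2 w] contains [- K x^2 v^2 w]. Completing the square absorbs the
    cross term [2 x v v' w] into half of it plus [(2 / K) v'^2 w], and the other half is what gets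
    bounded. *)
Lemma gauss_second_moment_le v : smooth v ->
  K * itgl (- L) L (fun x => x ^+ 2 * v x ^+ 2 * w x) <=
    2 * itgl (- L) L (fun x => v x ^+ 2 * w x) +
    4 / K * itgl (- L) L (fun x => derive1 v x ^+ 2 * w x).
Proof.
move=> sv; have cv := smooth_continuous sv.
have cv' := smooth_continuous (smooth_derive1 sv).
pose P x := x * (v x ^+ 2 * w x).
have sP : smooth P.
  exact: (smoothM smooth_id (smoothM (smoothX 2 sv) (smooth_weight K))).
have P'E x : derive1 P x = v x ^+ 2 * w x + 2 * x * v x * derive1 v x * w x
    - K * (x ^+ 2 * v x ^+ 2 * w x).
  have dv := smooth_is_derive x sv.
  have dP := is_deriveM (is_derive_id x (1 : R))
    (is_deriveM (is_deriveX 2 dv) (is_derive_weight K x)).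
  rewrite derive1E (@derive_val _ _ _ _ _ _ _ dP) /GRing.scale/= !fctE -/w; ring.
have cP' := smooth_continuous (smooth_derive1 sP).
have iv : itgble (- L) L (fun x => v x ^+ 2 * w x).
  by apply/continuous_itgble/continuous_mul => //; exact: continuous_sqr.
have iv' : itgble (- L) L (fun x => derive1 v x ^+ 2 * w x).
  by apply/continuous_itgble/continuous_mul => //; exact: continuous_sqr.
have ixv : itgble (- L) L (fun x => x ^+ 2 * v x ^+ 2 * w x).
  apply/continuous_itgble/continuous_mul => //; apply: continuous_mul.
    exact: exprn_continuous.
  exact: continuous_sqr.
have : itgl (- L) L (derive1 P) <= itgl (- L) L
    (fun x => (v x ^+ 2 * w x + 2 / K * (derive1 v x ^+ 2 * w x))
              + (- K / 2) * (x ^+ 2 * v x ^+ 2 * w x)).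
  apply: le_itgl; first exact: continuous_itgble.
    by apply: itgbleD; [apply: itgbleD => //|]; exact: itgbleZ.
  move=> x _; rewrite P'E -subr_ge0.
  set r := derive1 v x.
  have -> : v x ^+ 2 * w x + 2 / K * (r ^+ 2 * w x) +
      - K / 2 * (x ^+ 2 * v x ^+ 2 * w x) -
      (v x ^+ 2 * w x + 2 * x * v x * r * w x - K * (x ^+ 2 * v x ^+ 2 * w x)) =
      (K / 2) * (x * v x - 2 / K * r) ^+ 2 * w x.
    by field; rewrite gt_eqF.
  by rewrite !(sqr_ge0, mulr_ge0) ?invr_ge0//; exact: ltW.
rewrite itglD; [|by apply: itgbleD => //; exact: itgbleZ|exact: itgbleZ].
rewrite itglD//; last exact: itgbleZ.
rewrite !itglZ// (itgl_derive (ltW LL) cP' (fun x => smooth_is_derive x sP)).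
(* Both endpoints contribute with the favourable sign, because [x] is positive at [L] and negative
   at [- L]. *)
have : 0 <= P L - P (- L).
  by rewrite /P mulNr opprK addr_ge0// !(sqr_ge0, mulr_ge0)//; exact: ltW.
move=> h1 h2; have := le_trans h1 h2; lra.
Qed.


(** Obtained by solving [V <= 16 e^2 (E / K) + V / 2 + E / K] for [V]. *)
Definition gauss_poincare_cst : R := 2 * (16 * expR 2 + 1).
(** With [a1] the previous constant, the entropy is at most [68 V + (96 + 8 a1) (E / K)], and
    [V <= a1 (E / K)]. *)
Definition gauss_log_sobolev_cst : R := 76 * gauss_poincare_cst + 96.

Section centered.
Variable f : R -> R.
Hypothesis sf : smooth f.
Let v x := f x - f 0.
Let E := itgl (- L) L (fun x => derive1 f x ^+ 2 * w x).
Let V := itgl (- L) L (fun x => v x ^+ 2 * w x).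
Let E0 : 0 <= E.
Proof. by apply: itgl_ge0 => x; rewrite mulr_ge0 ?sqr_ge0// ltW. Qed.
Let sv : smooth v. Proof. exact: (smoothB sf (smooth_cst (f 0))). Qed.
Let cv : continuous v. Proof. exact: smooth_continuous sv. Qed.
Let cf' : continuous (derive1 f).
Proof. exact: smooth_continuous (smooth_derive1 sf). Qed.
Let v'E : derive1 v = derive1 f.
Proof.
apply: is_derive1E => x.
by have := is_deriveB (smooth_is_derive x sf) (is_derive_cst (f 0) x (1 : R)); rewrite subr0.
Qed.
Let cE : continuous (fun x => derive1 f x ^+ 2 * w x).
Proof. by apply: continuous_mul => //; exact: continuous_sqr. Qed.

Let invw x : (w x)^-1 = expR (2^-1 * K * x ^+ 2).
Proof. by rewrite /w /weight expRN invrK. Qed.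

(** Cauchy-Schwarz between 0 and [x]: since [1 / w] increases with the distance to 0, its integral
    over that segment is at most [|x| / w x]. The base point 0 is what makes this work. *)
Lemma gauss_pointwise x : - L <= x <= L -> v x ^+ 2 * w x <= E * `|x|.
Proof.
move=> /andP[Lx xL]; have cV : continuous (fun x => (w x)^-1).
  by move=> y; apply: cvgV; [rewrite gt_eqF|exact: cw].
rewrite -ler_pdivlMr//.
have h (a b : R) : a <= b -> - L <= a -> b <= L ->
    (forall y, a <= y <= b -> (w y)^-1 <= (w x)^-1) ->
    (f b - f a) ^+ 2 <= E * ((b - a) / w x).
  move=> ab La bL hw.
  apply: le_trans (itgl_cauchy_schwarz ab cf' cw w0 _) _ => [y|].
    exact: smooth_is_derive.
  apply: ler_pM.
  - by apply: itgl_ge0 => y; rewrite mulr_ge0 ?sqr_ge0// ltW.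
  - by apply: itgl_ge0 => y; rewrite invr_ge0 ltW.
  - apply: le_itgl_subset => //; last by move=> y; rewrite mulr_ge0 ?sqr_ge0// ltW.
    exact: continuous_itgble.
  - rewrite mulrC -itgl_cst//; apply: le_itgl => //; first exact: continuous_itgble.
    exact/continuous_itgble/cst_continuous.
have hw y : y ^+ 2 <= x ^+ 2 -> (w y)^-1 <= (w x)^-1.
  by move=> yx; rewrite !invw ler_expR ler_wpM2l// mulr_ge0 ?invr_ge0// ltW.
have [x0|x0] := leP 0 x.
  rewrite ger0_norm// -mulrA -[x in _ * (x / _)]subr0; apply: h => //.
    by rewrite oppr_le0 ltW.
  by move=> y /andP[y0 yx]; apply: hw; rewrite lerXn2r.
rewrite ltr0_norm// -mulrA -[- x]add0r /v -sqrrN opprB; apply: h => //.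
- exact: ltW.
- exact: ltW.
- by move=> y /andP[xy y0]; apply: hw; rewrite -sqrrN -[leRHS]sqrrN lerXn2r ?nnegrE ?lerN2//; lra.
Qed.

(* Where [K x^2 >= 4] the integrand is controlled by [K x^2 v^2 w / 4], half of
   the second-moment bound; elsewhere [w] is bounded below and the pointwise
   bound applies. *)
Lemma gauss_poincare : V <= gauss_poincare_cst * (E / K).
Proof.
have iv : itgble (- L) L (fun x => v x ^+ 2 * w x).
  by apply/continuous_itgble/continuous_mul => //; exact: continuous_sqr.
have iw : itgble (- L) L w by exact: continuous_itgble.
have ixv : itgble (- L) L (fun x => x ^+ 2 * v x ^+ 2 * w x).
  apply/continuous_itgble/continuous_mul => //; apply: continuous_mul.
    exact: exprn_continuous.
  exact: continuous_sqr.
(* Where [K x^2 < 4] one has [|x| <= 2 / rK] and [1 <= exp 2 * w x], so that [A w] dominates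
   [E |x|]. *)
pose A := 2 / rK * (E * expR 2).
have A0 : 0 <= A by rewrite !mulr_ge0 ?invr_ge0 ?expR_ge0// ltW.
have h1 : V <= A * c + K / 4 * itgl (- L) L (fun x => x ^+ 2 * v x ^+ 2 * w x).
  rewrite -!itglZ// -itglD; [|exact: itgbleZ..].
  apply: le_itgl => //; first by apply: itgbleD; exact: itgbleZ.
  move=> x xL; have vw : 0 <= v x ^+ 2 * w x by rewrite mulr_ge0 ?sqr_ge0// ltW.
  have [big|small] := leP 4 (K * x ^+ 2).
    have : 0 <= A * w x by rewrite mulr_ge0// ltW.
    have : v x ^+ 2 * w x * 4 <= v x ^+ 2 * w x * (K * x ^+ 2) by rewrite ler_wpM2l.
    have -> : K / 4 * (x ^+ 2 * v x ^+ 2 * w x) = v x ^+ 2 * w x * (K * x ^+ 2) / 4 by field.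
    lra.
  apply: (@le_trans _ _ (A * w x)); last first.
    by rewrite lerDl !(sqr_ge0, mulr_ge0) ?invr_ge0//; exact: ltW.
  apply: le_trans (gauss_pointwise xL) _.
  have we : 1 <= expR 2 * w x.
    rewrite /w /weight -expRD -[leLHS]expR0 ler_expR; lra.
  have xr : `|x| <= 2 / rK.
    rewrite ler_pdivlMr// -[rK]ger0_norm ?(ltW rK0)// -normrM.
    rewrite -ler_sqr ?nnegrE// real_normK ?num_real// exprMn rK2 mulrC; lra.
  rewrite (_ : A * w x = E * (2 / rK * (expR 2 * w x))); last by rewrite /A; ring.
  apply: ler_wpM2l => //.
  by rewrite (le_trans xr)// ler_peMr// divr_ge0// ltW.
have := @gauss_second_moment_le _ sv; rewrite v'E -/V -/E => h2.
have h3 : A * c <= 16 * expR 2 * (E / K).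
  have -> : A * c = 2 * expR 2 * (E / K) * (c * rK).
    by rewrite /A -rK2; field; rewrite gt_eqF.
  rewrite (_ : 16 * _ * _ = 2 * expR 2 * (E / K) * 8); last by ring.
  by rewrite ler_wpM2l ?gauss_mass_le// !mulr_ge0 ?expR_ge0 ?invr_ge0// ltW.
have EK : 4 / K * E = 4 * (E / K) by rewrite mulrAC -mulrA.
rewrite EK in h2; rewrite /gauss_poincare_cst; lra.
Qed.

Hypothesis f_mean : itgl (- L) L (fun x => (f x ^+ 2 - 1) * w x) = 0.

(** [entropy_le] is used with [m = f 0], [l2 = K x^2] and [l1] a multiple of [e = E / (K c)], so
    that [l1 c] is a multiple of [E / K]. The two [l2] terms are controlled by the second-moment
    bound, once for [v] and once for the constant 1. *)
Lemma log_sobolev_gauss :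
  itgl (- L) L (fun x => f x ^+ 2 * ln (f x ^+ 2) * w x) <=
    gauss_log_sobolev_cst / K * E.
Proof.
have cf := smooth_continuous sf.
have VE := gauss_poincare; set a1 := gauss_poincare_cst in VE.
have a10 : 0 <= a1 by rewrite !(mulr_ge0, addr_ge0)// expR_ge0.
pose e := E / K / c.
have e0 : 0 <= e by rewrite !divr_ge0// ltW.
have ec : e * c = E / K by rewrite /e divfK// gt_eqF.
have dV := sqr_dist1_mass_le cw w0 cf f_mean (f 0).
set d := (1 - `|f 0|) ^+ 2 in dV.
have d0 : 0 <= d by rewrite sqr_ge0.
have de : d <= a1 * e.
  by rewrite /e mulrA ler_pdivlMr// (le_trans dV).
have cK : continuous (fun x => K * x ^+ 2).
  by apply: continuous_mul; [exact: cst_continuous|exact: exprn_continuous].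
(* The value of [l1] comes from [v^2 <= 8 e exp (K x^2)] and [(1 - |f 0|)^2 <= a1 e], both proved
   separately, together with [y <= exp y]. *)
have h := @entropy_le _ (- L) L w f cw w0 cf f_mean (f 0) (8 * (8 + a1) * e)
  (fun x => K * x ^+ 2).
have {}h := h _ cK.
have M2 : itgl (- L) L (fun x => K * x ^+ 2 * w x) <= 2 * c.
  have := gauss_second_moment_le (smooth_cst 1).
  rewrite (is_derive1E (fun x => is_derive_cst (1 : R) x (1 : R))).
  under eq_fun do rewrite expr1n mulr1.
  under [X in _ <= _ * itgl _ _ X + _]eq_fun do rewrite expr1n mul1r.
  under [X in _ <= _ + _ * itgl _ _ X]eq_fun do rewrite expr0n mul0r.
  rewrite itgl_cst ?(ltW LL)// mul0r mulr0 addr0 -itglZ.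
    by under eq_fun do rewrite mulrA.
  by apply/continuous_itgble/continuous_mul => //; exact: exprn_continuous.
have X2 : itgl (- L) L (fun x => K * x ^+ 2 * v x ^+ 2 * w x) <= 2 * V + 4 / K * E.
  have := @gauss_second_moment_le _ sv; rewrite v'E -/V -/E -itglZ.
    by rewrite (_ : (fun x => K * _) = fun x => K * x ^+ 2 * v x ^+ 2 * w x)//;
      apply/funext => x; rewrite !mulrA.
  apply/continuous_itgble/continuous_mul => //; apply: continuous_mul.
    exact: exprn_continuous.
  exact: continuous_sqr.
apply: le_trans (h _ _ _) _.
- by rewrite mulr_ge0// mulr_ge0// addr_ge0.
- by move=> x; rewrite mulr_ge0 ?sqr_ge0// ltW.
- move=> x xL; rewrite -/(v x) -/d.
  have pw := gauss_pointwise xL.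
  set t := expR (2^-1 * K * x ^+ 2).
  have t1 : 1 + 2^-1 * K * x ^+ 2 <= t by exact: expR_ge1Dx.
  have K2 : 0 <= 2^-1 * K * x ^+ 2.
    by rewrite !(sqr_ge0, mulr_ge0) ?invr_ge0// ltW.
  (* Here [t = 1 / w x]. The pointwise bound is [v^2 <= E |x| t] with [E |x| = e (c rK) (rK |x|)],
     where [c rK <= 8] by [gauss_mass_le] and [rK |x| <= t]. *)
  have vx : v x ^+ 2 <= 8 * e * t ^+ 2.
    have {}pw : v x ^+ 2 <= E * `|x| * t by rewrite /t -invw ler_pdivlMr.
    have xt : rK * `|x| <= t.
      apply: le_trans t1; have : (rK * `|x|) ^+ 2 = K * x ^+ 2.
        by rewrite exprMn rK2 real_normK ?num_real.
      have := sqr_ge0 (rK * `|x| - 1); move: (rK * `|x|) => y; nra.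
    apply: (le_trans pw); rewrite expr2 mulrA ler_pM2r ?expR_gt0//.
    have -> : E * `|x| = e * (c * rK) * (rK * `|x|).
      by rewrite /e -rK2; field; rewrite !gt_eqF.
    rewrite (mulrC 8); apply: ler_pM => //.
    - exact: mulr_ge0 e0 (ltW (mulr_gt0 c0 rK0)).
    - exact: mulr_ge0 (ltW rK0) (normr_ge0 x).
    - by rewrite ler_wpM2l ?gauss_mass_le.
  have te : expR (K * x ^+ 2) = t ^+ 2 by rewrite /t -expRM_natl; congr expR; field.
  have t21 : 1 <= t ^+ 2 by rewrite expr_ge1 ?(le_trans _ t1) ?lerDl ?addr_ge0.
  rewrite expRD te.
  apply: (@le_trans _ _ (8 * (8 + a1) * e * t ^+ 2)); last first.
    by rewrite ler_wpM2r ?sqr_ge0// (le_trans _ (expR_ge1Dx _)) ?lerDr.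
  have : a1 * e <= a1 * e * t ^+ 2 by rewrite ler_peMr// mulr_ge0.
  rewrite (_ : 8 * (8 + a1) * e * t ^+ 2 = 8 * (8 * e * t ^+ 2 + a1 * e * t ^+ 2)); last by ring.
  lra.
rewrite -/(v _) -/c -/d -/V.
have -> : 8 * (8 + a1) * e * c = 8 * (8 + a1) * (E / K) by rewrite -mulrA ec.
have -> : gauss_log_sobolev_cst / K * E = gauss_log_sobolev_cst * (E / K).
  by rewrite mulrAC mulrA.
have EK : 4 / K * E = 4 * (E / K) by rewrite mulrAC mulrA.
have dM2 : d * itgl (- L) L (fun x => K * x ^+ 2 * w x) <= 2 * V.
  by apply: le_trans (ler_wpM2l d0 M2) _; rewrite mulrCA ler_pM2l.
rewrite EK in X2; rewrite /gauss_log_sobolev_cst -/a1.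
move: (E / K) VE X2 => q VE X2; rewrite mulrDl; lra.
Qed.

End centered.
End gauss_interval.
End log_sobolev_gauss.

(** * Test functions and comparison of the two constants *)

Section test_functions.
Variable R : realType.
Local Open Scope classical_set_scope.
Local Open Scope ring_scope.
Implicit Types (f g : R -> R) (L M : R).

Lemma vanishing_compactly_supported f L :
  (forall x, L < `|x| -> f x = 0) -> compactly_supported f.
Proof.
move=> f0; apply: (@subclosed_compact _ _ `[- L, L]).
- exact: closed_closure.
- exact: segment_compact.
- apply: (@subset_trans _ (closure `[- L, L])); last exact: interval_closed.
  apply: closureS => x /= fx; rewrite in_itv/= -ler_norml leNgt.
  by apply/negP => /f0 fx0; rewrite fx0 eqxx in fx.
Qed.

Lemma derive1_vanishing f L :
  (forall x, L < `|x| -> f x = 0) -> forall x, L < `|x| -> derive1 f x = 0.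
Proof.
move=> f0 x Lx; rewrite derive1E.
have -> : 'D_1 f x = 'D_1 (cst (0 : R)) x; last exact: derive_cst.
apply: near_eq_derive; near=> y; rewrite f0//; near: y.
exact: (cvgr_gt _ (@norm_continuous _ R x)).
Unshelve. all: by end_near. Qed.

Lemma compactly_supported_vanishing f : compactly_supported f ->
  exists2 L : R, 0 < L & forall x, L < `|x| -> f x = 0.
Proof.
move=> /compact_bounded[M [_ hM]]; exists (`|M| + 1); first by rewrite ltr_wpDl.
move=> x; apply: contraTeq => fx; rewrite -leNgt.
have h : M < `|M| + 1 by rewrite (le_lt_trans (ler_norm M))// ltrDl.
by apply: (hM _ h); apply: subset_closure.
Qed.

Lemma continuous_vanishing_bounded f L : continuous f ->
  (forall x, L < `|x| -> f x = 0) -> exists2 M : R, 0 <= M & forall x, `|f x| <= M.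
Proof.
move=> cf f0; have [M M0 fM] := @continuous_bounded _ f (- L) L cf.
exists M => // x; have [xL|Lx] := leP `|x| L; first by rewrite fM// -ler_norml.
by rewrite f0// normr0.
Qed.

Lemma test_function_bounded f : test_function f ->
  exists M : R, forall x, `|f x| <= M /\ `|derive1 f x| <= M.
Proof.
move=> [sf /compactly_supported_vanishing[L L0 f0]].
have [M M0 fM] := continuous_vanishing_bounded (smooth_continuous sf) f0.
have [N N0 fN] := continuous_vanishing_bounded
  (smooth_continuous (smooth_derive1 sf)) (derive1_vanishing f0).
exists (M + N) => x; split.
  by rewrite (le_trans (fM x))// lerDl.
by rewrite (le_trans (fN x))// lerDr.
Qed.

End test_functions.

(** * The two constants for an arbitrary probability measure on the line *)

Section comparison.
Variable R : realType.
Local Open Scope classical_set_scope.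
Local Open Scope ring_scope.
Variable P : probability (measurableTypeR R) R.
Implicit Types (f g : R -> R) (L M : R).

Lemma bounded_integrable f M : measurable_fun setT f ->
  (forall x, `|f x| <= M) -> P.-integrable setT (EFin \o f).
Proof.
move=> mf fM; apply: measurable_bounded_integrable => //.
  by rewrite -ge0_fin_numE ?fin_num_measure.
exists M; split; first exact: num_real.
by move=> e /ltW Me x _; exact: le_trans (fM x) Me.
Qed.

Lemma measurable_xlnx f : continuous f ->
  measurable_fun setT (fun x => f x ^+ 2 * ln (f x ^+ 2)).
Proof.
move=> cf; have mf : measurable_fun setT f by exact: continuous_measurable_fun.
apply: measurable_funM; first exact: measurable_funX.
by apply: (measurableT_comp (@measurable_ln R)); exact: measurable_funX.
Qed.

Lemma xlnx_bounded f M : (forall x, `|f x ^+ 2 - 1| <= M) ->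
  forall x, `|f x ^+ 2 * ln (f x ^+ 2)| <= 1 + (M + 1) * M.
Proof.
move=> fM x; have h1 := xlnx_ge (f x); have h2 := xlnx_le (f x).
have s0 := sqr_ge0 (f x); have s1 := sqr_ge0 (`|f x| - 1).
have := fM x; move: s0 h1 h2; set s := f x ^+ 2; set l := s * ln s.
rewrite ler_norml => s0 h1 h2 /andP[ha hb].
have M0 : 0 <= M by lra.
by rewrite ler_norml; apply/andP; split; nra.
Qed.

(** By [xlnx_ge] the integrand is at least [f^2 - 1 = g], which has mean 0. A nonzero denominator of
    the log-Sobolev quotient is therefore positive. *)
Lemma entropy_ge0 f g M : continuous f -> continuous g ->
  (forall x, `|g x| <= M) -> \int[P]_x g x = 0 ->
  (forall x, f x ^+ 2 = 1 + g x) ->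
  0 <= \int[P]_x (f x ^+ 2 * ln (f x ^+ 2)).
Proof.
move=> cf cg gM g0 fg; rewrite -g0.
have gE x : f x ^+ 2 - 1 = g x by rewrite fg addrC addKr.
apply: le_Rintegral => //.
- by apply: (@bounded_integrable _ M) => //; exact: continuous_measurable_fun.
- apply: (bounded_integrable (measurable_xlnx cf)); apply: xlnx_bounded.
  by move=> x; rewrite gE.
- move=> x _; rewrite -gE; apply: le_trans (xlnx_ge (f x)).
  by rewrite lerDl sqr_ge0.
Qed.

(** [M] is the explicit rate between the two constants: [Lambda_Poi] is at most [C1 M], and every
    log-Sobolev quotient is at least [2 M / C2]. *)
Lemma Lambda_LS_ge (M C1 C2 : R) : 0 < M -> 0 < C1 -> 0 < C2 ->
  (Lambda_Poi P <= (C1 * M)%:E)%E ->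
  (forall f g, smooth f -> test_function g -> \int[P]_x g x = 0 ->
    (forall x, f x ^+ 2 = 1 + g x) ->
    M * \int[P]_x (f x ^+ 2 * ln (f x ^+ 2)) <= C2 * \int[P]_x (derive1 f x) ^+ 2) ->
  ((2 / (C1 * C2))%:E * Lambda_Poi P <= Lambda_LS P)%E.
Proof.
move=> M0 C10 C20 Poi LS; apply/ereal_infP => _ [f [sf [g [tg _ g0 fg]] ->]].
rewrite /rayleigh; case: eqP => [_|/eqP B0]; first by rewrite leey.
have [N gN] := test_function_bounded tg.
have Bge0 := @entropy_ge0 f g N (smooth_continuous sf) (smooth_continuous tg.1)
  (fun x => (gN x).1) g0 fg.
have := LS f g sf tg g0 fg; move: B0 Bge0; set B := \int[P]_x _; set A := \int[P]_x _.
move=> B0 Bge0 LSB; have {Bge0}B0 : 0 < B by rewrite lt_neqAle eq_sym B0.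
apply: (@le_trans _ _ ((2 / (C1 * C2))%:E * (C1 * M)%:E)%E).
  by apply: lee_wpmul2l => //; rewrite lee_fin divr_ge0// mulr_ge0// ltW.
rewrite -EFinM lee_fin ler_pdivlMr//.
have -> : 2 / (C1 * C2) * (C1 * M) * B = 2 / C2 * (M * B).
  by field; rewrite !gt_eqF.
by rewrite mulrAC ler_pdivrMr// [leRHS]mulrC [leRHS]mulrCA ler_pM2l.
Qed.

(** A single small [e] suffices: for [f = sqrt (1 + e h)] with [|e h| <= 1/2] the energy is at most
    [e^2 / 2] times that of [h] and the entropy is at least [e^2 / 9] times [\int h^2], so the
    factor [e^2] cancels. *)
Lemma Lambda_LS_le : (Lambda_LS P <= 9%:E * Lambda_Poi P)%E.
Proof.
rewrite -lee_pdivrMl//; apply/ereal_infP => _ [h [th h_neq0 h0 ->]].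
rewrite lee_pdivrMl// /rayleigh; case: eqP => [_|/eqP b_neq0].
  by rewrite gt0_muley ?lte_fin// leey.
have [N hN] := test_function_bounded th.
have N0 : 0 <= N by rewrite (le_trans _ (hN 0).1).
pose e := (2 * (N + 1))^-1.
have e0 : 0 < e by rewrite invr_gt0; lra.
have sh := th.1.
pose g x := e * h x.
have g2 x : `|g x| <= 2^-1.
  rewrite /g normrM gtr0_norm// /e invfM -mulrA ler_piMr ?invr_ge0//.
  by rewrite ler_pdivrMl; have := (hN x).1; lra.
have g2' x : - 2^-1 <= g x <= 2^-1 by rewrite -ler_norml.
pose f x := Num.sqrt (1 + g x).
have sg : smooth g by exact: (smoothM (smooth_cst e) sh).
have p0 x : 0 < 1 + g x by have /andP[? ?] := g2' x; lra.
have sp : smooth (fun x => 1 + g x) by exact: (smoothD (smooth_cst 1) sg).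
have sf : smooth f by exact: smooth_sqrt.
have f2 x : f x ^+ 2 = 1 + g x by rewrite sqr_sqrtr// ltW.
have f0 x : 0 < f x by rewrite sqrtr_gt0.
have f'E x : derive1 f x ^+ 2 = (e ^+ 2 / 4) / (1 + g x) * derive1 h x ^+ 2.
  have dg : is_derive x (1 : R) (fun y => 1 + g y) (e * derive1 h x).
    have := is_deriveD (is_derive_cst (1 : R) x (1 : R))
      (is_deriveZ e (smooth_is_derive x sh)).
    by rewrite add0r.
  have ds := @is_derive1_comp _ Num.sqrt (fun y => 1 + g y) x _ _
    (is_derive1_sqrt (p0 x)) dg.
  rewrite derive1E (@derive_val _ _ _ _ _ _ _ ds) -/(f x) -f2.
  by field; rewrite gt_eqF ?f0.
have tg : test_function g.
  split=> //; have [L L0 hL] := compactly_supported_vanishing th.2.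
  by apply: (@vanishing_compactly_supported _ _ L) => x Lx; rewrite /g hL ?mulr0.
have mh : measurable_fun setT h.
  by apply: continuous_measurable_fun; exact: smooth_continuous.
have mh' : measurable_fun setT (derive1 h).
  by apply: continuous_measurable_fun; exact/smooth_continuous/smooth_derive1.
have ih : P.-integrable setT (EFin \o h).
  by apply: (@bounded_integrable _ N) => // x; exact: (hN x).1.
have ih2 : P.-integrable setT (EFin \o (fun x => h x ^+ 2)).
  apply: (@bounded_integrable _ (N ^+ 2)); first exact: measurable_funX.
  by move=> x; rewrite normrX lerXn2r ?nnegrE// (hN x).1.
have ih'2 : P.-integrable setT (EFin \o (fun x => derive1 h x ^+ 2)).
  apply: (@bounded_integrable _ (N ^+ 2)); first exact: measurable_funX.
  by move=> x; rewrite normrX lerXn2r ?nnegrE// (hN x).2.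
set a := \int[P]_x _; set b := \int[P]_x _ in b_neq0 *.
have b0 : 0 < b.
  rewrite lt_neqAle eq_sym b_neq0; apply: Rintegral_ge0 => x _; exact: sqr_ge0.
pose A := \int[P]_x (derive1 f x) ^+ 2.
pose B := \int[P]_x (f x ^+ 2 * ln (f x ^+ 2)).
have le_f' x : derive1 f x ^+ 2 <= e ^+ 2 / 2 * derive1 h x ^+ 2.
  rewrite f'E ler_wpM2r ?sqr_ge0// ler_pdivrMr//.
  by have /andP[? ?] := g2' x; have := sqr_ge0 e; nra.
have A_le : A <= e ^+ 2 / 2 * a.
  rewrite /a -RintegralZl//; apply: le_Rintegral => //.
  - apply: (@bounded_integrable _ (e ^+ 2 / 2 * N ^+ 2)).
      apply: measurable_funX; apply: continuous_measurable_fun.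
      exact/smooth_continuous/smooth_derive1.
    move=> x; rewrite ger0_norm ?sqr_ge0// (le_trans (le_f' x))//.
    apply: ler_wpM2l; first by rewrite divr_ge0 ?sqr_ge0.
    rewrite -[leLHS]real_normK ?num_real//.
    by rewrite lerXn2r ?nnegrE// (hN x).2.
  - exact: (integrableZl _ (e ^+ 2 / 2) ih'2).
(* [xlnx_ge] gives [f^2 ln (f^2) >= g + (f - 1)^2]; the term [g] has mean 0, and
   [f - 1 = g / (f + 1)] with [f + 1 <= 3]. *)
have B_ge : e ^+ 2 / 9 * b <= B.
  have -> : e ^+ 2 / 9 * b = \int[P]_x (e * h x + e ^+ 2 / 9 * h x ^+ 2).
    rewrite RintegralD//; first by rewrite !RintegralZl// h0 mulr0 add0r.
      exact: (integrableZl _ e ih).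
    exact: (integrableZl _ (e ^+ 2 / 9) ih2).
  apply: le_Rintegral => //.
  - exact: (integrableD _ (integrableZl measurableT e ih)
      (integrableZl measurableT (e ^+ 2 / 9) ih2)).
  - apply: (bounded_integrable (measurable_xlnx (smooth_continuous sf))).
    by apply: (@xlnx_bounded _ 2^-1) => x; rewrite f2 addrC addKr.
  - move=> x _; apply: le_trans (xlnx_ge (f x)); rewrite gtr0_norm//.
    have := f0 x; have := f2 x; have := g2' x; rewrite -/(g x).
    have -> : e ^+ 2 / 9 * h x ^+ 2 = g x ^+ 2 / 9 by rewrite /g; ring.
    move: (f x) (g x) => s u /andP[u1 u2] su s0.
    have s2 : s <= 2 by nra.
    have -> : u = (s - 1) * (s + 1) by move: su; lra.
    have : (s + 1) ^+ 2 <= 9 by nra.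
    have := sqr_ge0 (s - 1).
    by rewrite exprMn; nra.
apply: (@le_trans _ _ (rayleigh (2 * A) B)).
  apply: ereal_inf_lbound; exists f; split=> //; exists g; split=> //.
  - move=> g00; apply: h_neq0; apply/funext => x.
    have := congr1 (fun u => u x) g00; rewrite /g /= => /eqP.
    by rewrite mulf_eq0 gt_eqF//= => /eqP.
  - by rewrite RintegralZl// h0 mulr0.
have B0 : 0 < B by apply: lt_le_trans B_ge; rewrite mulr_gt0// divr_gt0// exprn_gt0.
rewrite /rayleigh gt_eqF// -EFinM lee_fin ler_pdivrMr//.
have a0 : 0 <= a by apply: Rintegral_ge0 => x _; exact: sqr_ge0.
apply: (@le_trans _ _ (9 * (a / b) * (e ^+ 2 / 9 * b))); last first.
  by rewrite ler_wpM2l// mulr_ge0// divr_ge0// ltW.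
have -> : 9 * (a / b) * (e ^+ 2 / 9 * b) = 2 * (e ^+ 2 / 2 * a).
  by field; rewrite gt_eqF.
by rewrite ler_pM2l.
Qed.

End comparison.

(** * Integrals against xi *)

Section xi_integral.
Variable R : realType.
Local Open Scope classical_set_scope.
Local Open Scope ring_scope.
Local Notation leb := (@lebesgue_measure R).
Variables (K : R) (D : \bar R) (D0 : (0 < D)%E) (KD : K <= 0 -> (D < +oo)%E).
Local Notation xi := (xi D0 KD).

Lemma xi_dominated : xi `<< leb.
Proof.
apply/null_content_dominatesP => A mA A0; apply: null_set_integral => //=.
by apply/measurable_EFinP/measurable_funTS; exact: measurable_xi_pdf.
Qed.

(** The density [xi_pdf] agrees almost everywhere with the Radon-Nikodym derivative, both having the
    same integral over every measurable set. *)
Lemma integral_xi (f : R -> \bar R) : xi.-integrable setT f ->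
  (\int[xi]_x f x = \int[leb]_x (f x * (xi_pdf K D x)%:E))%E.
Proof.
move=> intf; have mf := measurable_int _ intf.
rewrite -(Radon_Nikodym_change_of_variables xi_dominated)//=.
apply: ae_eq_integral => //.
- apply: emeasurable_funM => //; apply: (measurable_int leb).
  by apply: Radon_Nikodym_integrable; exact: xi_dominated.
- apply: emeasurable_funM => //; apply/measurable_EFinP.
  exact: measurable_xi_pdf.
- apply: ae_eqe_mul2l => /=.
  rewrite Radon_NikodymE//=; first exact: xi_dominated.
  move=> dom; case: cid => /= h [h1 h2 h3].
  apply: integral_ae_eq => //=.
  + by apply/measurable_EFinP; exact: measurable_xi_pdf.
  + by move=> A _ mA; rewrite -h3.
Qed.

(** The interval [[-L, L]] may be smaller than the support of [xi], so that [D = +oo] is also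
    reduced to integrals over compact intervals. *)
Lemma Rintegral_xi (f : R -> R) M L : measurable_fun setT f ->
  (forall x, `|f x| <= M) -> `[- L, L] `<=` half_itv D ->
  (forall x, half_itv D x -> ~ (- L <= x <= L) -> f x = 0) ->
  \int[xi]_x f x =
    (norm_const K D)^-1 * itgl (- L) L (fun x => f x * weight K x).
Proof.
move=> mf fM LD f0; have intf := bounded_integrable _ mf fM.
have [N N0 wN] := @continuous_bounded _ (weight K) (- L) L (@continuous_weight _ K).
have intfw : itgble (- L) L (fun x => f x * weight K x).
  apply: measurable_bounded_integrable => //.
  - by rewrite /= lebesgue_measure_itv/=; case: ifP; rewrite ?ltry.
  - apply: measurable_funM; last exact: measurable_weight.
    exact: (@measurable_funS _ _ _ _ setT).
  - exists (M * N); split; first exact: num_real.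
    move=> e /ltW he x /=; rewrite in_itv/= => xL.
    by rewrite (le_trans _ he)// normrM ler_pM// wN.
rewrite -itglZ// /itgl [RHS]Rintegral_mkcond /Rintegral integral_xi//.
congr fine; apply: eq_integral => x _ /=; rewrite patchE /xi_pdf indicE -EFinM.
congr EFin; case: ifPn => [/set_mem /LD xD|xL].
  by rewrite mem_set// mulr1 mulrCA.
case: (boolP (x \in half_itv D)) => [/set_mem xD|_]; last by rewrite !mulr0.
rewrite f0 ?mul0r// => xL'; move/negP: xL; apply; apply/mem_set.
by rewrite /= in_itv.
Qed.

End xi_integral.

(** * Upper bounds on the Poincare constant *)

Section xi_bounds.
Variable R : realType.
Local Open Scope classical_set_scope.
Local Open Scope ring_scope.
Implicit Types (f g : R -> R) (K L l x : R).

Lemma itgl_odd g L : 0 <= L -> continuous g -> (forall x, g (- x) = - g x) ->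
  itgl (- L) L g = 0.
Proof.
move=> L0 cg odd; have LL : - L <= L by rewrite ge0_cp.
have h : itgl (- L) L g = itgl (- L) L (fun x => - 1 * g x).
  rewrite /itgl /Rintegral; congr fine.
  have := @integration_by_substitution_oppr R g (- L) L LL.
  rewrite opprK => ->; last exact/continuous_subspaceT.
  by apply: eq_integral => x _ /=; rewrite odd mulN1r.
move: h; rewrite itglZ ?mulN1r; last exact: continuous_itgble.
by lra.
Qed.

(** Where [f^2 = 1] on an open set, [2 f f' = 0] with [f] nonzero. Hence [f'] has compact support
    although [f] does not. *)
Lemma derive1_sqr_vanishing f g L : smooth f -> (forall x, f x ^+ 2 = 1 + g x) ->
  (forall x, L < `|x| -> g x = 0) -> forall x, L < `|x| -> derive1 f x = 0.
Proof.
move=> sf fg g0 x Lx.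
have df := is_deriveX 2 (smooth_is_derive x sf).
have h : derive1 (fun y => f y ^+ 2 - 1) x = 0.
  by apply: (@derive1_vanishing _ _ L) => // y Ly; rewrite fg g0// addr0 subrr.
have d2 := is_deriveB df (is_derive_cst (1 : R) x (1 : R)).
move: h; rewrite derive1E (_ : (fun y => f y ^+ 2 - 1) = f ^+ 2 - cst 1)//.
rewrite (@derive_val _ _ _ _ _ _ _ d2) /GRing.scale/= subr0 expr1.
have fx : f x != 0.
  apply/eqP => fx; have := fg x; rewrite fx g0// addr0 expr0n/= => /eqP.
  by rewrite eq_sym oner_eq0.
by move/eqP; rewrite !mulf_eq0 (negbTE fx) pnatr_eq0 orbF/= => /eqP.
Qed.

(** * Transfer between [xi] and weighted integrals over an interval *)

Section fixed_measure.
Variables (K : R) (D : \bar R) (D0 : (0 < D)%E) (KD : K <= 0 -> (D < +oo)%E).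
Local Notation xi := (xi D0 KD).
Local Notation w := (weight K).

Let not_itv L x : ~ (- L <= x <= L) -> L < `|x|.
Proof. by rewrite -ler_norml => /negP; rewrite -ltNge. Qed.

(** The inequality is homogeneous in the measure: both sides carry the same factor
    [(norm_const K D)^-1]. *)
Lemma xi_log_sobolev L Q f g : smooth f -> test_function g ->
  \int[xi]_x g x = 0 -> (forall x, f x ^+ 2 = 1 + g x) ->
  `[- L, L] `<=` half_itv D ->
  (forall x, half_itv D x -> L < `|x| -> g x = 0 /\ derive1 f x = 0) ->
  (itgl (- L) L (fun x => (f x ^+ 2 - 1) * w x) = 0 ->
   itgl (- L) L (fun x => f x ^+ 2 * ln (f x ^+ 2) * w x) <=
     Q * itgl (- L) L (fun x => derive1 f x ^+ 2 * w x)) ->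
  \int[xi]_x (f x ^+ 2 * ln (f x ^+ 2)) <= Q * \int[xi]_x (derive1 f x) ^+ 2.
Proof.
move=> sf tg g0 fg LD out LS; have c0 := norm_const_gt0 D0 KD.
have cg := smooth_continuous tg.1; have cf := smooth_continuous sf.
have cf' := smooth_continuous (smooth_derive1 sf).
have [N gN] := test_function_bounded tg.
have [L' _ g0'] := compactly_supported_vanishing tg.2.
have [N' N'0 f'N] := continuous_vanishing_bounded cf' (derive1_sqr_vanishing sf fg g0').
have gE x : g x = f x ^+ 2 - 1 by rewrite fg addrC addKr.
have mean : itgl (- L) L (fun x => (f x ^+ 2 - 1) * w x) = 0.
  have := @Rintegral_xi _ K D D0 KD g N L (continuous_measurable_fun cg)
    (fun x => (gN x).1) LD (fun x xD xL => (out x xD (not_itv xL)).1).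
  rewrite g0; under eq_fun do rewrite gE.
  by move=> /esym/eqP; rewrite mulf_eq0 invr_eq0 gt_eqF//= => /eqP.
rewrite (@Rintegral_xi _ K D D0 KD _ (1 + (N + 1) * N) L) //; first last.
- by move=> x xD xL; rewrite fg (out x xD (not_itv xL)).1 addr0 ln1 mulr0.
- by apply: xlnx_bounded => x; rewrite -gE (gN x).1.
- exact: measurable_xlnx.
rewrite (@Rintegral_xi _ K D D0 KD _ (N' ^+ 2) L) //; first last.
- by move=> x xD xL; rewrite (out x xD (not_itv xL)).2 expr0n.
- by move=> x; rewrite normrX lerXn2r ?nnegrE.
- by apply: measurable_funX; exact: continuous_measurable_fun.
by rewrite [leRHS]mulrCA; apply: ler_wpM2l; [rewrite invr_ge0 ltW|exact: LS].
Qed.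

(** An odd function has mean 0 because the weight is even, and the normalisation cancels in the
    quotient. *)
Lemma Lambda_Poi_le_test L A B f : 0 <= L -> test_function f ->
  (forall x, f (- x) = - f x) -> `[- L, L] `<=` half_itv D ->
  (forall x, half_itv D x -> L < `|x| -> f x = 0 /\ derive1 f x = 0) ->
  itgl (- L) L (fun x => derive1 f x ^+ 2 * w x) <= A ->
  0 < B -> B <= itgl (- L) L (fun x => f x ^+ 2 * w x) ->
  (Lambda_Poi xi <= (A / B)%:E)%E.
Proof.
move=> L0 tf odd LD out fA B0 fB; have c0 := norm_const_gt0 D0 KD.
have cf := smooth_continuous tf.1.
have cf' := smooth_continuous (smooth_derive1 tf.1).
have [N fN] := test_function_bounded tf.
have N0 : 0 <= N by rewrite (le_trans _ (fN 0).1).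
set A' := itgl _ _ _ in fA; set B' := itgl _ _ _ in fB.
have B'0 : 0 < B' by exact: lt_le_trans fB.
have A'0 : 0 <= A' by apply: itgl_ge0 => x; rewrite mulr_ge0 ?sqr_ge0// expR_ge0.
have iB : \int[xi]_x (f x) ^+ 2 = (norm_const K D)^-1 * B'.
  apply: (@Rintegral_xi _ K D D0 KD _ (N ^+ 2)) => //.
  - by apply: measurable_funX; exact: continuous_measurable_fun.
  - by move=> x; rewrite normrX lerXn2r ?nnegrE// (fN x).1.
  - by move=> x xD xL; rewrite (out x xD (not_itv xL)).1 expr0n.
have iA : \int[xi]_x (derive1 f x) ^+ 2 = (norm_const K D)^-1 * A'.
  apply: (@Rintegral_xi _ K D D0 KD _ (N ^+ 2)) => //.
  - by apply: measurable_funX; exact: continuous_measurable_fun.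
  - by move=> x; rewrite normrX lerXn2r ?nnegrE// (fN x).2.
  - by move=> x xD xL; rewrite (out x xD (not_itv xL)).2 expr0n.
have i0 : \int[xi]_x f x = 0.
  rewrite (@Rintegral_xi _ K D D0 KD _ N L)//.
  - rewrite itgl_odd ?mulr0//.
      by apply: continuous_mul => //; exact: continuous_weight.
    by move=> x; rewrite odd /weight sqrrN mulNr.
  - exact: continuous_measurable_fun.
  - by move=> x; exact: (fN x).1.
  - by move=> x xD xL; exact: (out x xD (not_itv xL)).1.
apply: (@le_trans _ _ (A' / B')%:E); last first.
  by rewrite lee_fin ler_pM ?invr_ge0 ?(ltW B'0)// lef_pV2 ?posrE.
apply: ereal_inf_lbound; exists f; split => //.
- move=> f0; move: B'0; rewrite /B' f0 /=.
  under eq_fun do rewrite expr0n/= mul0r.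
  by rewrite itgl_cst ?ge0_cp// mul0r ltxx.
- rewrite iA iB /rayleigh mulf_eq0 invr_eq0 !gt_eqF//=.
  by congr EFin; field; rewrite !gt_eqF.
Qed.

End fixed_measure.

(** Up to the scale [|K|^(-1/2)] the weight is comparable to 1, whatever the sign of [K]. *)
Lemma weight_bounds K l x : `|K| * l ^+ 2 <= 1 -> `|x| <= l ->
  expR (- 1) <= weight K x <= expR 1.
Proof.
move=> Kl xl; have h : `|K * x ^+ 2| <= 1.
  rewrite normrM normrX (le_trans _ Kl)// ler_wpM2l// lerXn2r ?nnegrE//.
  exact: le_trans xl.
move: h; rewrite ler_norml /weight !ler_expR -mulrA; lra.
Qed.

(** A smooth sign function: [-1] up to [-1/2] and [1] from [1/2] on. *)
Definition odd_step (t : R) : R := 2 * smooth_step (t + 2^-1) - 1.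

Lemma smooth_odd_step : smooth odd_step.
Proof.
apply: (smoothB _ (smooth_cst 1)); apply: (smoothM (smooth_cst 2)).
exact: (smooth_comp (@smooth_smooth_step R) (smoothD smooth_id (smooth_cst 2^-1))).
Qed.

Lemma odd_stepN t : odd_step (- t) = - odd_step t.
Proof.
rewrite /odd_step (_ : - t + 2^-1 = 1 - (t + 2^-1)); last by field.
by rewrite smooth_step_sym; ring.
Qed.

Lemma odd_step1 t : 2^-1 <= t -> odd_step t = 1.
Proof. by move=> t1; rewrite /odd_step smooth_step1; lra. Qed.

Lemma odd_step_sqr1 t : 2^-1 <= `|t| -> odd_step t ^+ 2 = 1.
Proof.
move=> t1; have [t0|t0] := leP 0 t.
  by rewrite odd_step1 ?expr1n// -(ger0_norm t0).
by rewrite -sqrrN -odd_stepN odd_step1 ?expr1n// -(ltr0_norm t0).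
Qed.

Lemma derive1_smooth_step x : x < 0 \/ 1 < x -> derive1 (@smooth_step R) x = 0.
Proof.
move=> x01; rewrite derive1E; case: x01 => hx.
- have -> : 'D_1 (@smooth_step R) x = 'D_1 (cst (0 : R)) x; last exact: derive_cst.
  by apply: near_eq_derive; near=> y; rewrite smooth_step0// ltW//; near: y; exact: lt_nbhsl.
- have -> : 'D_1 (@smooth_step R) x = 'D_1 (cst (1 : R)) x; last exact: derive_cst.
  by apply: near_eq_derive; near=> y; rewrite smooth_step1// ltW//; near: y; exact: lt_nbhsr.
Unshelve. all: by end_near. Qed.

Lemma derive1_odd_step t : 2^-1 < `|t| -> derive1 odd_step t = 0.
Proof.
move=> t1; apply: (@derive1_sqr_vanishing _ (fun x => odd_step x ^+ 2 - 1) 2^-1) => //.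
- exact: smooth_odd_step.
- by move=> x; ring.
- by move=> x x1; rewrite odd_step_sqr1 ?subrr// ltW.
Qed.

Lemma derive1_scale f l x : smooth f ->
  derive1 (fun y => f (y / l)) x = derive1 f (x / l) / l.
Proof.
move=> sf; have dl : is_derive x (1 : R) (fun y => y / l) l^-1.
  have := is_deriveZ l^-1 (is_derive_id x (1 : R)).
  rewrite /GRing.scale/= mulr1; congr (is_derive _ _ _ _).
  by apply/funext => y; rewrite mulrC.
have d := @is_derive1_comp _ f (fun y => y / l) x _ _
  (smooth_is_derive (x / l) sf) dl.
by rewrite derive1E (@derive_val _ _ _ _ _ _ _ d).
Qed.

Lemma smooth_scale f l : smooth f -> smooth (fun y => f (y / l)).
Proof. by move=> sf; exact: (smooth_comp sf (smoothM smooth_id (smooth_cst l^-1))). Qed.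

Arguments smooth_scale [f] l _.

(** * Rescaled steps and bumps as test functions *)

Section steps.
Variables (K : R) (D : \bar R) (D0 : (0 < D)%E) (KD : K <= 0 -> (D < +oo)%E).
Local Notation xi := (xi D0 KD).
Local Notation w := (weight K).


(* The test function is a step at the scale [l], on which [w] is comparable to
   [1], cut off only outside of [-L, L], where [xi] vanishes. *)
Lemma Lambda_Poi_le_step M L l : (forall t, `|derive1 odd_step t| <= M) ->
  half_itv D = `[- L, L]%classic -> 0 < l -> l <= L -> `|K| * l ^+ 2 <= 1 ->
  (Lambda_Poi xi <= (2 * M ^+ 2 * expR 1 * (1 + 2 * expR 2) /
     (l * itgl (- L) L w))%:E)%E.
Proof.
move=> sM DL l0 lL Kl; have L0 : 0 < L by exact: lt_le_trans lL.
have M0 : 0 <= M by rewrite (le_trans _ (sM 0)).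
have w0 x : 0 < w x by exact: expR_gt0.
have cw : continuous w by exact: continuous_weight.
(* The 2 keeps the argument above 1 on all of [[-L, L]], endpoints included, so that [cut] is 1
   there with zero derivative; beyond [L + 2] the argument is negative. *)
pose cut x : R := smooth_step (2 + L ^+ 2 - x ^+ 2).
pose f x := odd_step (x / l) * cut x.
have spoly : smooth (fun x : R => 2 + L ^+ 2 - x ^+ 2).
  exact: (smoothB (smooth_cst (2 + L ^+ 2)) (smoothX 2 smooth_id)).
have scut : smooth cut by exact: (smooth_comp (@smooth_smooth_step R) spoly).
have sstep := smooth_scale l smooth_odd_step.
have sf : smooth f by exact: (smoothM sstep scut).
have cf := smooth_continuous sf; have cf' := smooth_continuous (smooth_derive1 sf).
have cE : continuous (fun x => derive1 f x ^+ 2 * w x).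
  by apply: continuous_mul => //; exact: continuous_sqr.
have xL2 x : - L <= x <= L -> x ^+ 2 <= L ^+ 2.
  by rewrite -ler_norml => xL; rewrite -[x ^+ 2]real_normK ?num_real// lerXn2r ?nnegrE// ltW.
have f'E x : - L <= x <= L -> derive1 f x = derive1 odd_step (x / l) / l.
  move=> xL; have d := is_deriveM (smooth_is_derive x sstep) (smooth_is_derive x scut).
  rewrite derive1E (@derive_val _ _ _ _ _ _ _ d) derive1_scale; last exact: smooth_odd_step.
  have dc : derive1 cut x = 0.
    have d' := is_derive1_comp (smooth_is_derive _ (@smooth_smooth_step R))
      (smooth_is_derive x spoly).
    rewrite derive1E (@derive_val _ _ _ _ _ _ _ d') derive1_smooth_step ?mul0r//.
    by right; have := xL2 x xL; lra.
  rewrite dc scaler0 add0r /cut smooth_step1 /GRing.scale/= ?mul1r//.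
  by have := xL2 x xL; lra.
have f2E x : - L <= x <= L -> f x ^+ 2 = odd_step (x / l) ^+ 2.
  move=> xL; rewrite /f /cut smooth_step1 ?mulr1//.
  by have := xL2 x xL; lra.
have out x : half_itv D x -> L < `|x| -> f x = 0 /\ derive1 f x = 0.
  by rewrite DL /= in_itv/= -ler_norml => /le_lt_trans h /h; rewrite ltxx.
set c := itgl (- L) L w.
have c0 : 0 < c by apply: itgl_gt0 => //; lra.
have -> : 2 * M ^+ 2 * expR 1 * (1 + 2 * expR 2) / (l * c) =
    (2 * M ^+ 2 * expR 1 / l) / (c / (1 + 2 * expR 2)).
  field; rewrite !gt_eqF//; have := expR_gt0 (2 : R); lra.
have e2 : 0 < 1 + 2 * expR (2 : R) by have := expR_gt0 (2 : R); lra.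
have xl_le x : - l <= x <= l -> expR (- 1) <= w x <= expR 1.
  by rewrite -ler_norml; exact: weight_bounds.
apply: (@Lambda_Poi_le_test _ _ _ _ L _ _ f) => //.
- exact: ltW.
- split=> //; apply: (@vanishing_compactly_supported _ _ (L + 2)) => x xL.
  rewrite /f /cut smooth_step0 ?mulr0//.
  by rewrite -[x ^+ 2]real_normK ?num_real//; nra.
- by move=> x; rewrite /f mulNr odd_stepN /cut sqrrN mulNr.
- by rewrite DL.
(* The energy is carried by [[-l, l]], where it is at most [(M / l)^2 exp 1] times the length
   [2 l]. *)
- rewrite (@itgl_split _ _ (- l)); [|lra|lra|exact: continuous_itgble].
  rewrite (@itgl_split _ (- l) l L); [|lra|lra|exact: continuous_itgble].
  have outer a b : - L <= a -> b <= L -> a <= b -> (l <= a \/ b <= - l) ->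
      itgl a b (fun x => derive1 f x ^+ 2 * w x) <= 0.
    move=> La bL ab lab; rewrite -[leRHS](mul0r (b - a)) -itgl_cst//.
    apply: le_itgl; [exact: continuous_itgble|exact/continuous_itgble/cst_continuous|].
    move=> x /andP[ax xb]; rewrite f'E; last by apply/andP; split; lra.
    rewrite derive1_odd_step ?mul0r ?expr0n/= ?mul0r//.
    rewrite normrM normfV (gtr0_norm l0) ltr_pdivlMr//.
    rewrite ltr_normr; apply/orP; case: lab => ?; [left|right]; lra.
  have h1 := outer (- L) (- l); have h2 := outer l L.
  have h3 : itgl (- l) l (fun x => derive1 f x ^+ 2 * w x) <= 2 * M ^+ 2 * expR 1 / l.
    have -> : 2 * M ^+ 2 * expR 1 / l = (M ^+ 2 / l ^+ 2 * expR 1) * (l - - l).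
      by field; rewrite gt_eqF.
    rewrite -itgl_cst; last lra.
    apply: le_itgl; [exact: continuous_itgble|exact/continuous_itgble/cst_continuous|].
    move=> x xl; rewrite f'E; last by apply/andP; move: xl => /andP[? ?]; split; lra.
    apply: ler_pM; rewrite ?sqr_ge0 ?(ltW (w0 x))//; last by case/andP: (xl_le x xl).
    rewrite exprMn exprVn ler_pM2r ?invr_gt0 ?exprn_gt0//.
    by rewrite -[leLHS]real_normK ?num_real// lerXn2r ?nnegrE.
  have {}h1 : itgl (- L) (- l) (fun x => derive1 f x ^+ 2 * w x) <= 0.
    by apply: h1; [|lra|lra|right].
  have {}h2 : itgl l L (fun x => derive1 f x ^+ 2 * w x) <= 0.
    by apply: h2; [lra| |lra|left].
  lra.
- by rewrite divr_gt0.
- rewrite ler_pdivrMr//.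
  have cF : continuous (fun x => f x ^+ 2 * w x).
    by apply: continuous_mul => //; exact: continuous_sqr.
  have split3 g : continuous g -> itgl (- L) L g =
      itgl (- L) (- (l / 2)) g + itgl (- (l / 2)) (l / 2) g + itgl (l / 2) L g.
    move=> cg; rewrite (@itgl_split _ _ (- (l / 2))); [|lra|lra|exact: continuous_itgble].
    rewrite (@itgl_split _ (- (l / 2)) (l / 2) L) ?addrA//; [lra|lra|exact: continuous_itgble].
  have outer a b : - L <= a -> b <= L -> (l / 2 <= a \/ b <= - (l / 2)) ->
      itgl a b w <= itgl a b (fun x => f x ^+ 2 * w x).
    move=> La bL lab; apply: le_itgl; [exact: continuous_itgble..|].
    move=> x /andP[ax xb]; rewrite f2E; last by apply/andP; split; lra.
    rewrite odd_step_sqr1 ?mul1r//.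
    rewrite normrM normfV (gtr0_norm l0) ler_pdivlMr//.
    rewrite ler_normr; apply/orP; case: lab => ?; [left|right]; lra.
  have h1 : itgl (- L) (- (l / 2)) w <= itgl (- L) (- (l / 2)) (fun x => f x ^+ 2 * w x).
    by apply: outer; [|lra|right].
  have h2 : itgl (l / 2) L w <= itgl (l / 2) L (fun x => f x ^+ 2 * w x).
    by apply: outer; [lra| |left].
  have m0 : 0 <= itgl (- (l / 2)) (l / 2) (fun x => f x ^+ 2 * w x).
    by apply: itgl_ge0 => x; rewrite mulr_ge0 ?sqr_ge0// ltW.
  have m1 : itgl (- (l / 2)) (l / 2) w <= l * expR 1.
    have -> : l * expR 1 = expR 1 * (l / 2 - - (l / 2)) by field.
    rewrite -itgl_cst; last lra.
    apply: le_itgl; [exact: continuous_itgble|exact/continuous_itgble/cst_continuous|].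
    move=> x /andP[? ?]; have /andP[] // : expR (- 1) <= w x <= expR 1.
    by apply: xl_le; apply/andP; split; lra.
  have s0 : 0 <= itgl (- L) (- (l / 2)) w by apply: itgl_ge0 => x; exact: ltW.
  have r1 : l / 2 * expR (- 1) <= itgl (l / 2) L w.
    apply: (@le_trans _ _ (itgl (l / 2) l w)).
      have -> : l / 2 * expR (- 1) = expR (- 1) * (l - l / 2) by field.
      rewrite -itgl_cst; last lra.
      apply: le_itgl; [exact/continuous_itgble/cst_continuous|exact: continuous_itgble|].
      move=> x /andP[? ?]; have /andP[] // : expR (- 1) <= w x <= expR 1.
      by apply: xl_le; apply/andP; split; lra.
    apply: le_itgl_subset => //; first exact: continuous_itgble.
    by move=> x; exact: ltW.
  rewrite /c (split3 w cw) (split3 _ cF).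
  have mr : l * expR 1 <= 2 * expR 2 * itgl (l / 2) L w.
    have -> : l * expR 1 = 2 * expR 2 * (l / 2 * expR (- 1)).
      have : expR 2 * expR (- 1) = expR (1 : R) by rewrite -expRD; congr expR; lra.
      by move=> <-; field.
    by rewrite ler_pM2l// mulr_gt0// expR_gt0.
  have e20 := expR_gt0 (2 : R).
  have : 0 <= 2 * expR 2 * (itgl (- L) (- (l / 2)) (fun x => f x ^+ 2 * w x) +
     itgl (- (l / 2)) (l / 2) (fun x => f x ^+ 2 * w x)).
    by rewrite mulr_ge0 ?addr_ge0 ?mulr_ge0 ?(ltW e20)// (le_trans s0).
  have : 2 * expR 2 * itgl (l / 2) L w <=
      2 * expR 2 * itgl (l / 2) L (fun x => f x ^+ 2 * w x).
    by rewrite ler_pM2l// mulr_gt0.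
  lra.
Qed.

(** The identity, cut off smoothly between [|t| = 2^(-1/2)] and [|t| = 1]. *)
Definition odd_bump (t : R) : R := t * smooth_step (2 - 2 * t ^+ 2).

Let spoly : smooth (fun t : R => 2 - 2 * t ^+ 2).
Proof. exact: (smoothB (smooth_cst 2) (smoothM (smooth_cst 2) (smoothX 2 smooth_id))). Qed.

Lemma smooth_odd_bump : smooth odd_bump.
Proof. exact: (smoothM smooth_id (smooth_comp (@smooth_smooth_step R) spoly)). Qed.

Lemma odd_bump_eq0 t : 1 < `|t| -> odd_bump t = 0.
Proof.
move=> t1; rewrite /odd_bump smooth_step0 ?mulr0//.
by rewrite -[t ^+ 2]real_normK ?num_real//; nra.
Qed.

(** At the scale [l = K^(-1/2)] the energy is at most a constant times [1 / l]. On [[l/4, l/2]] the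
    bump equals [x / l >= 1/4], so [\int f^2 w] is at least a constant times [l]; the quotient is of
    order [l^-2 = K]. *)
Lemma Lambda_Poi_le_gauss M l : (forall t, `|derive1 odd_bump t| <= M) ->
  0 < l -> K * l ^+ 2 = 1 -> `[- l, l] `<=` half_itv D ->
  (Lambda_Poi xi <= (128 * M ^+ 2 * expR 2 * K)%:E)%E.
Proof.
move=> sM l0 Kl lD.
have K0 : 0 < K by rewrite -(pmulr_lgt0 _ (exprn_gt0 2 l0)) Kl.
have M0 : 0 <= M by rewrite (le_trans _ (sM 0)).
have w0 x : 0 < w x by exact: expR_gt0.
have cw : continuous w by exact: continuous_weight.
pose f x := odd_bump (x / l).
have sf : smooth f by exact: (smooth_scale l smooth_odd_bump).
have cf := smooth_continuous sf; have cf' := smooth_continuous (smooth_derive1 sf).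
have f0 x : l < `|x| -> f x = 0.
  by move=> lx; rewrite /f odd_bump_eq0// normrM normfV (gtr0_norm l0) ltr_pdivlMr ?mul1r.
have xl_le x : - l <= x <= l -> expR (- 1) <= w x <= expR 1.
  by rewrite -ler_norml; apply: weight_bounds; rewrite gtr0_norm// Kl.
have -> : 128 * M ^+ 2 * expR 2 * K = (2 * M ^+ 2 * expR 1 / l) / (l * expR (- 1) / 64).
  have -> : K = l ^- 2 by rewrite -[RHS]mul1r -Kl mulfK// gt_eqF// exprn_gt0.
  rewrite (_ : expR 2 = expR 1 * expR 1) ?expRN; last by rewrite -expRD; congr expR; lra.
  by field; rewrite !gt_eqF// expR_gt0.
apply: (@Lambda_Poi_le_test _ _ _ _ l _ _ f) => //.
- exact: ltW.
- by split=> //; exact: vanishing_compactly_supported f0.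
- by move=> x; rewrite /f /odd_bump mulNr sqrrN mulNr.
- by move=> x _ lx; split; [exact: f0|exact: (derive1_vanishing f0)].
- have -> : 2 * M ^+ 2 * expR 1 / l = (M ^+ 2 / l ^+ 2 * expR 1) * (l - - l).
    by field; rewrite gt_eqF.
  rewrite -itgl_cst; last lra.
  apply: le_itgl; [|exact/continuous_itgble/cst_continuous|].
    by apply/continuous_itgble/continuous_mul => //; exact: continuous_sqr.
  move=> x xl; rewrite /f derive1_scale; last exact: smooth_odd_bump.
  apply: ler_pM; rewrite ?sqr_ge0 ?(ltW (w0 x))//; last by case/andP: (xl_le x xl).
  rewrite exprMn exprVn ler_pM2r ?invr_gt0 ?exprn_gt0//.
  by rewrite -[leLHS]real_normK ?num_real// lerXn2r ?nnegrE.
- by rewrite divr_gt0// mulr_gt0// expR_gt0.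
- have cF : continuous (fun x => f x ^+ 2 * w x).
    by apply: continuous_mul => //; exact: continuous_sqr.
  apply: (@le_trans _ _ (itgl (l / 4) (l / 2) (fun x => f x ^+ 2 * w x))); last first.
    apply: le_itgl_subset; [lra|lra|exact: continuous_itgble|].
    by move=> x; rewrite mulr_ge0 ?sqr_ge0// ltW.
  have -> : l * expR (- 1) / 64 = (16^-1 * expR (- 1)) * (l / 2 - l / 4) by field.
  rewrite -itgl_cst; last lra.
  apply: le_itgl; [exact/continuous_itgble/cst_continuous|exact: continuous_itgble|].
  move=> x /andP[lx xl].
  have t1 : 4^-1 <= x / l by rewrite ler_pdivlMr//; lra.
  have t2 : x / l <= 2^-1 by rewrite ler_pdivrMr//; lra.
  have -> : f x = x / l by rewrite /f /odd_bump smooth_step1 ?mulr1//; nra.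
  apply: ler_pM; rewrite ?invr_ge0 ?expR_ge0//; first nra.
  have /andP[] // : expR (- 1) <= w x <= expR 1.
  by apply: xl_le; apply/andP; split; lra.
Qed.

End steps.

End xi_bounds.

(** * The equivalence *)

(** For finite [D] this is the support of [xi]; for [D = +oo] it is an interval around the support
    of [g]. In the second case [L] depends on [g], so only bounds uniform in [L] can be used. *)
Lemma exhausting_interval (R : realType) (D : \bar R) (f g : R -> R) :
  (0 < D)%E -> smooth f -> test_function g -> (forall x, f x ^+ 2 = 1 + g x) ->
  exists L : R, [/\ 0 < L, (`[- L, L]%classic `<=` half_itv D)%classic &
    forall x, half_itv D x -> L < `|x| -> g x = 0 /\ derive1 f x = 0].
Proof.
move=> D0 sf tg fg; have [L L0 g0] := compactly_supported_vanishing tg.2.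
case: D D0 => [d|_|//].
  rewrite lte_fin => d0; exists (d * 2^-1); rewrite half_itv_fin divr_gt0//; split=> //.
  by move=> x /=; rewrite in_itv/= -ler_norml => /le_lt_trans h /h; rewrite ltxx.
exists L; rewrite half_itv_pinfty; split=> // x _ Lx; split; first exact: g0.
exact: (derive1_sqr_vanishing sf fg g0).
Qed.

Theorem theorem7p3p19 (R : realType) :
  exists c C : R, [/\ 0 < c, 0 < C &
    forall (K : R) (D : \bar R) (D0 : (0 < D)%E) (KD : K <= 0 -> (D < +oo)%E),
      (c%:E * Lambda_Poi (xi D0 KD) <= Lambda_LS (xi D0 KD))%E /\
      (Lambda_LS (xi D0 KD) <= C%:E * Lambda_Poi (xi D0 KD))%E].
Proof.
(* [M1] and [M2] belong to two fixed profiles, which makes [C1] and [C2] independent of [K] and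
   [D]. *)
have [M1 _ bump_le] := continuous_vanishing_bounded
  (smooth_continuous (smooth_derive1 (@smooth_odd_bump R)))
  (derive1_vanishing (@odd_bump_eq0 R)).
have [M2 _ step_le] := continuous_vanishing_bounded
  (smooth_continuous (smooth_derive1 (@smooth_odd_step R)))
  (@derive1_odd_step R).
pose C1 : R := 128 * M1 ^+ 2 * expR 2 + 2 * M2 ^+ 2 * expR 1 * (1 + 2 * expR 2) + 1.
(* [416 = 52 * 8]: the constant of [log_sobolev_oscillation] times that of the bound on [\int w^-1]
   assumed in [step]. *)
pose C2 : R := gauss_log_sobolev_cst R + 416 * expR 1.
have e1 := expR_gt0 (1 : R); have e2 := expR_gt0 (2 : R).
have c1a : 0 <= 128 * M1 ^+ 2 * expR 2 by rewrite !(sqr_ge0, mulr_ge0)// ltW.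
have c1b : 0 <= 2 * M2 ^+ 2 * expR 1 * (1 + 2 * expR 2).
  by rewrite !(sqr_ge0, mulr_ge0)//; lra.
have gls : 0 <= gauss_log_sobolev_cst R.
  by rewrite /gauss_log_sobolev_cst /gauss_poincare_cst; lra.
have C10 : 0 < C1 by rewrite /C1; lra.
have C20 : 0 < C2 by rewrite /C2; lra.
exists (2 / (C1 * C2)), 9; split=> //; first by rewrite divr_gt0// mulr_gt0.
move=> K D D0 KD; split; last exact: Lambda_LS_le.
have E0 (f : R -> R) : 0 <= \int[xi D0 KD]_x (derive1 f x) ^+ 2.
  by apply: Rintegral_ge0 => x _; exact: sqr_ge0.
have gauss : 0 < K -> (forall x, `|x| <= (Num.sqrt K)^-1 -> half_itv D x) ->
    ((2 / (C1 * C2))%:E * Lambda_Poi (xi D0 KD) <= Lambda_LS (xi D0 KD))%E.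
  move=> K0 lD; apply: (@Lambda_LS_ge _ _ K) => //.
    have K1 : K * (Num.sqrt K)^-1 ^+ 2 = 1.
      by rewrite exprVn sqr_sqrtr ?(ltW K0)// mulfV// gt_eqF.
    apply: le_trans (Lambda_Poi_le_gauss D0 KD bump_le _ K1 _) _.
    - by rewrite invr_gt0 sqrtr_gt0.
    - by move=> x /=; rewrite in_itv/= -ler_norml; exact: lD.
    - by rewrite lee_fin ler_pM2r// /C1; lra.
  move=> f g sf tg g0 fg.
  have [L [L0 LD out]] := exhausting_interval D0 sf tg fg.
  have := xi_log_sobolev sf tg g0 fg LD out (log_sobolev_gauss K0 L0 sf).
  rewrite -(ler_pM2l K0) mulrA [K * (_ / _)]mulrC divfK ?gt_eqF// => /le_trans; apply.
  by rewrite ler_wpM2r// /C2; lra.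
(* The rate is [(l c)^-1]: the bound on [\int w^-1] turns the oscillation constant [c \int w^-1]
   into a multiple of [l c]. *)
have step (L l : R) : half_itv D = `[- L, L]%classic -> 0 < l -> l <= L ->
    `|K| * l ^+ 2 <= 1 ->
    itgl (- L) L (fun x => (weight K x)^-1) <= 8 * expR 1 * l ->
    ((2 / (C1 * C2))%:E * Lambda_Poi (xi D0 KD) <= Lambda_LS (xi D0 KD))%E.
  move=> DL l0 lL Kl Bl; have LL : - L < L by lra.
  have cw := @continuous_weight _ K.
  have w0 x : 0 < weight K x by exact: expR_gt0.
  have c0 : 0 < itgl (- L) L (weight K) by exact: itgl_gt0.
  set c := itgl _ _ _ in c0; have lc0 : 0 < l * c by rewrite mulr_gt0.
  apply: (@Lambda_LS_ge _ _ (l * c)^-1) => //; first by rewrite invr_gt0.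
    apply: le_trans (Lambda_Poi_le_step D0 KD step_le DL l0 lL Kl) _.
    by rewrite lee_fin ler_pM2r ?invr_gt0// /C1; lra.
  move=> f g sf tg g0 fg.
  have LD : (`[- L, L]%classic `<=` half_itv D)%classic by rewrite DL.
  have out x : half_itv D x -> L < `|x| -> g x = 0 /\ derive1 f x = 0.
    by rewrite DL /= in_itv/= -ler_norml => /le_lt_trans h /h; rewrite ltxx.
  have := xi_log_sobolev sf tg g0 fg LD out (log_sobolev_oscillation LL cw w0 sf).
  rewrite -/c => h; rewrite mulrC ler_pdivrMr//; apply: (le_trans h).
  rewrite [leRHS]mulrAC; apply: ler_wpM2r; first exact: E0.
  apply: (@le_trans _ _ (416 * expR 1 * (l * c))); last first.
    by rewrite ler_pM2r// /C2; lra.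
  have -> : 416 * expR 1 * (l * c) = 52 * (c * (8 * expR 1 * l)) by ring.
  by rewrite ler_pM2l// ler_pM2l.
case: D D0 KD E0 gauss step => [d|D0 KD _ gauss _|//]; last first.
  apply: gauss; last by move=> x _; rewrite half_itv_pinfty.
  by rewrite ltNge; apply/negP => /KD.
move=> D0 KD E0 gauss step; have d0 : 0 < d by move: (D0); rewrite lte_fin.
pose L := d * 2^-1; have L0 : 0 < L by rewrite divr_gt0.
have DL : half_itv d%:E = `[- L, L]%classic by exact: half_itv_fin.
(* If [D/2] is at most [|K|^(-1/2)], the weight is comparable to 1 on the whole interval and [l = L]
   works. *)
have [KL|KL] := leP (`|K| * L ^+ 2) 1.
  apply: (step L L) => //.
  apply: (@le_trans _ _ (itgl (- L) L (fun=> expR 1))).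
    apply: le_itgl.
    - by apply: continuous_itgble => x; apply: cvgV;
        [rewrite gt_eqF// expR_gt0|exact: continuous_weight].
    - exact/continuous_itgble/cst_continuous.
    - move=> x; rewrite -ler_norml => xL; have /andP[h _] := weight_bounds KL xL.
      by rewrite -[leRHS]invrK -expRN lef_pV2 ?posrE ?expR_gt0.
  rewrite itgl_cst; last lra.
  have := mulr_gt0 e1 L0; lra.
have aK0 : 0 < `|K|.
  by rewrite normr_gt0; apply: contraTneq KL => ->; rewrite normr0 mul0r -leNgt.
pose l := (Num.sqrt `|K|)^-1; have l0 : 0 < l by rewrite invr_gt0 sqrtr_gt0.
have Kl : `|K| * l ^+ 2 = 1.
  by rewrite /l exprVn sqr_sqrtr ?(ltW aK0)// mulfV// gt_eqF.
have lL : l <= L.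
  rewrite -ler_sqr ?nnegrE ?(ltW l0) ?(ltW L0)// -(ler_pM2l aK0) Kl ltW//.
have [K0|K0] := leP K 0; last first.
  apply: gauss => // x xl; rewrite DL /= in_itv/= -ler_norml (le_trans _ lL)//.
  by rewrite /l (gtr0_norm K0).
apply: (step L l) => //; first by rewrite Kl.
have NK0 : 0 < - K by rewrite -(ler0_norm K0).
(* For [K < 0] the inverse weight is the Gaussian weight of parameter [|K|], whose mass is at most
   [8 |K|^(-1/2) = 8 l]. *)
have := gauss_mass_le NK0 L0; rewrite -ler_pdivlMr ?sqrtr_gt0// -(ler0_norm K0).
rewrite -/l => h; apply: (@le_trans _ _ (8 * l)); last first.
  by rewrite ler_pM2r// ler_peMr// -[leLHS]expR0 ler_expR.
apply: le_trans h; rewrite (_ : (fun x => (weight K x)^-1) = weight `|K|)//.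
apply/funext => x; rewrite /weight -expRN ler0_norm//; congr expR; ring.
Qed.
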